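(* Let $\alpha>-1$, $0\le\gamma<2+\alpha$ and $1<p\le q<\infty$. Let $\Phi$ and $\Psi$ be Young functions whose complementary functions belong to $B_p$ and $B_{q'}$ respectively. Let $\omega,\sigma$ be weights on $\mathcal H$ such that for some $C>0$ and every interval $I\subset\mathbb R$, $$|Q_I|_\alpha^{\frac{\gamma}{2+\alpha}+\frac1q-\frac1p}\,\|\omega\|_{Q_I,\Psi,\alpha}\,\|\sigma^{-1}\|_{Q_I,\Phi,\alpha}\le C.$$ Then there is $K>0$ such that for every $f\in L^p(\mathcal H,\sigma dV_\alpha)$, $$\left(\int_{\mathcal H}\big(\omega(z)T_{\alpha,\gamma}f(z)\big)^q dV_\alpha(z)\right)^{1/q}\le K\|f\sigma\|_{p,\alpha}.$$
   Context: $\mathcal H=\{x+iy:x\in\mathbb R,\ y>0\}$; for $\alpha>-1$, $dV_\alpha(x+iy)=y^\alpha dx\,dy$; $\|g\|_{p,\alpha}=(\int_{\mathcal H}|g|^pdV_\alpha)^{1/p}$; $q'$ is the conjugate exponent of $q$. A weight is a nonnegative locally integrable function. The positive fractional Bergman operator is $T_{\alpha,\gamma}f(z)=\int_{\mathcal H}\frac{f(w)}{|z-\overline w|^{2+\alpha-\gamma}}dV_\alpha(w)$. For an interval $I$, $Q_I=\{x+iy:x\in I,0<y<|I|\}$, $|Q_I|_\alpha=\int_{Q_I}dV_\alpha$. A Young function is a continuous convex increasing $\Phi:[0,\infty)\to[0,\infty)$ with $\Phi(0)=0$, $\Phi(t)\to\infty$; its complementary function is $s\mapsto\sup_{t\ge0}(ts-\Phi(t))$.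 Luxemburg norm: $\|f\|_{Q_I,\Phi,\alpha}=\inf\{\lambda>0:\frac1{|Q_I|_\alpha}\int_{Q_I}\Phi(|f|/\lambda)dV_\alpha\le1\}$. For $1<r<\infty$, a Young function $\Theta\in B_r$ means $\Theta$ satisfies $\Theta(2t)\le K\Theta(t)$ for some $K>1$ and all $t\ge0$, and $\int_c^\infty\frac{\Theta(t)}{t^r}\frac{dt}{t}<\infty$ for some $c>0$. *)

(* Defs.v *)
From HB Require Import structures.
From mathcomp Require Import all_boot all_order all_algebra.
From mathcomp Require Import all_classical all_reals all_analysis.
Set Implicit Arguments. Unset Strict Implicit. Unset Printing Implicit Defensive.
Import Order.TTheory GRing.Theory Num.Theory.
Import numFieldNormedType.Exports.
Local Open Scope classical_set_scope.
Local Open Scope ring_scope.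

Definition leb2 (R : realType) :=
  ((@lebesgue_measure R) \x (@lebesgue_measure R))%E.

Definition UHP (R : realType) : set (R * R) := [set z | 0 < z.2].

Definition Vint (R : realType) (a : R) (D : set (R * R))
    (g : R * R -> \bar R) : \bar R :=
  (\int[@leb2 R]_(z in D) ((z.2 `^ a)%:E * g z))%E.

Definition Vmeas (R : realType) (a : R) (D : set (R * R)) : \bar R :=
  Vint a D (fun _ => 1%E).

Definition Qbox (R : realType) (x1 x2 : R) : set (R * R) :=
  [set z | x1 <= z.1 <= x2 /\ 0 < z.2 < x2 - x1].

Definition Young (R : realType) (Phi : R -> R) : Prop :=
  {within [set t : R | 0 <= t], continuous Phi} /\
  (forall s t l : R, 0 <= s -> 0 <= t -> 0 <= l <= 1 ->
      Phi ((1 - l) * s + l * t) <= (1 - l) * Phi s + l * Phi t) /\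
  (forall s t : R, 0 <= s -> s <= t -> Phi s <= Phi t) /\
  (forall t : R, 0 <= t -> 0 <= Phi t) /\
  Phi 0 = 0 /\
  Phi x @[x --> +oo] --> +oo.

Definition complementary (R : realType) (Phi Theta : R -> R) : Prop :=
  forall s : R, 0 <= s ->
    (Theta s)%:E = ereal_sup [set ((t * s - Phi t)%:E) | t in [set t : R | 0 <= t]].

Definition B_class (R : realType) (r : R) (Theta : R -> R) : Prop :=
  [/\ Young Theta,
      (exists K : R, 1 < K /\ forall t : R, 0 <= t -> Theta (2 * t) <= K * Theta t) &
      (exists c : R, 0 < c /\
         (\int[@lebesgue_measure R]_(t in [set t : R | (c <= t)%R])
             (((Theta t / t `^ r / t)%R)%:E) < +oo)%E)].

(* Phi extended to \bar R (only used on nonnegative arguments) *)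
Definition PhiE (R : realType) (Phi : R -> R) (x : \bar R) : \bar R :=
  match x with
  | r%:E => (Phi r)%:E
  | _ => +oo%E
  end.

(* Luxemburg norm ||f||_{Q,Phi,a} (inf of the empty set is +oo) *)
Definition Luxemburg (R : realType) (a : R) (Phi : R -> R) (Q : set (R * R))
    (f : R * R -> \bar R) : \bar R :=
  ereal_inf [set l%:E | l in [set l : R | 0 < l /\
     (((fine (Vmeas a Q))^-1)%:E *
        Vint a Q (fun z => PhiE Phi (`|f z| * (l^-1)%:E)) <= 1)%E]].

Definition sigma_inv (R : realType) (sig : R * R -> R) (z : R * R) : \bar R :=
  if sig z == 0 then +oo%E else ((sig z)^-1)%:E.

Definition weight (R : realType) (w : R * R -> R) : Prop :=
  (forall z, UHP z -> 0 <= w z) /\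
  (forall K : set (R * R), compact K -> K `<=` @UHP R ->
     (@leb2 R).-integrable K (fun z => (w z)%:E)).

(* kernel 1 / |z - conj w|^(2 + a - g) *)
Definition kern (R : realType) (a g : R) (z w : R * R) : R :=
  ((Num.sqrt ((z.1 - w.1) ^+ 2 + (z.2 + w.2) ^+ 2)) `^ (2 + a - g))^-1.

Definition Tag (R : realType) (a g : R) (f : R * R -> R) (z : R * R) : \bar R :=
  Vint a (@UHP R) (fun w => (f w * kern a g z w)%:E).

(* Main.v *)
(** For [z, w] in the half-plane some dyadic interval [I] of length comparable to
    [|z - conj w|], taken from one of two grids shifted by a third of their length,
    satisfies [z, w \in Q_I]; so on compact sets the kernel is dominated by
    [sum_I |I|^(g-2-a) 1_{Q_I}(z) 1_{Q_I}(w)] over finite dyadic trees. Testing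
    against [h >= 0], Young's inequality turns [int_{Q_I} om h] and [int_{Q_I} |f|]
    into products of Luxemburg norms, and the bump condition bounds the [I]-th term by
    [|Q_I|^(1/p) ||f sig||_{Q_I,Phic} * |Q_I|^(1/q') ||h||_{Q_I,Psic}].
    Since [p <= q] the sum of these products is controlled by the two Carleson sums
    [sum_I |Q_I| ||F||_{Q_I,Theta}^r <= K int F^r], which hold for [Theta] in [B_r]:
    the boxes where the norm exceeds [t] have total volume at most a constant times
    [int_{F > e t} Theta (F / t)], because a fixed proportion of each [Q_I] lies outside
    the boxes of its two halves, and the sum of these bounds over dyadic [t] is
    comparable to [F^r]. Duality and an exhaustion by compact sets conclude. *)
Require Import Defs.
From HB Require Import structures.
From mathcomp Require Import all_boot all_order all_algebra.
From mathcomp Require Import all_classical all_reals all_analysis.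
From mathcomp Require Import measurable_realfun ring lra zify.
Import Order.TTheory GRing.Theory Num.Theory.
Import numFieldNormedType.Exports.
Local Open Scope classical_set_scope.
Local Open Scope ring_scope.

Set Implicit Arguments.
Unset Strict Implicit.
Unset Printing Implicit Defensive.

(** The exponent of the bump condition is dictated by scaling. If [V] is the volume of the box over
    an interval of length [l], the kernel contributes [l^(g-2-a)], comparable to [V^(g/(2+a)-1)],
    the two Hölder steps contribute [V^2], and dividing by [V^(g/(2+a)+1/q-1/p)] leaves exactly
    [V^(1/p) V^(1/q')]. These two factors are what the Carleson sums with exponents [p] and [q']
    absorb. The main obstacle is degenerate values: [sig] may vanish, so that its inverse is
    infinite; a Luxemburg norm may be 0 or infinite; infima need not be attained; and the duality
    argument divides by a quantity that must be finite and positive. Hence the trees are finite,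
    with constants independent of their depth and of the compact set; norms are replaced by
    arbitrary positive upper bounds or admissible values; and the compact sets grow only after all
    estimates are done. *)

(* Half-open in the first coordinate, so that the boxes of the two halves of an
   interval are disjoint. *)
Definition hbox {R : realType} (i : R * R) : set (R * R) :=
  [set z | i.1 <= z.1 < i.1 + i.2 /\ 0 < z.2 < i.2].

(** * Integration against [y^a dx dy] *)

Section weighted_integral.
Context {R : realType}.
Implicit Types (a : R) (D : set (R * R)) (g : R * R -> \bar R).

Lemma UHPE : @UHP R = [set: R] `*` `]0, +oo[.
Proof.
by apply/seteqP; split => z /=; rewrite /UHP /= in_itv/= andbT // => -[].
Qed.

Lemma hboxE (i : R * R) : hbox i = `[i.1, i.1 + i.2[ `*` `]0, i.2[.
Proof. by apply/seteqP; split => z /=; rewrite /hbox /= !in_itv/=. Qed.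

Lemma QboxE (x1 x2 : R) : Qbox x1 x2 = `[x1, x2] `*` `]0, x2 - x1[.
Proof. by apply/seteqP; split => z /=; rewrite /Qbox /= !in_itv/=. Qed.

Lemma measurable_UHP : measurable (@UHP R).
Proof. by rewrite UHPE; apply: measurableX. Qed.

Lemma measurable_hbox (i : R * R) : measurable (hbox i).
Proof. by rewrite hboxE; apply: measurableX. Qed.

Lemma measurable_Qbox (x1 x2 : R) : measurable (Qbox x1 x2).
Proof. by rewrite QboxE; apply: measurableX. Qed.

Lemma hbox_sub_UHP (i : R * R) : hbox i `<=` @UHP R.
Proof. by move=> z [_ /andP[]]. Qed.

Lemma Qbox_sub_UHP (x1 x2 : R) : Qbox x1 x2 `<=` @UHP R.
Proof. by move=> z [_ /andP[]]. Qed.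

Lemma measurable_weighted a D g : measurable D -> measurable_fun D g ->
  measurable_fun D (fun z => (z.2 `^ a)%:E * g z)%E.
Proof.
move=> mD mg; apply: emeasurable_funM => //.
apply/measurable_EFinP; apply/measurable_funTS.
apply: (measurableT_comp (f := (@powR R)^~ a)); first exact: measurable_powR.
exact: measurable_snd.
Qed.

Lemma Vint_ge0 a D g : (forall z, D z -> 0 <= g z)%E -> (0 <= Vint a D g)%E.
Proof.
by move=> g0; apply: integral_ge0 => z Dz; rewrite mule_ge0 ?lee_fin ?powR_ge0 ?g0.
Qed.

Lemma eq_Vint a D g1 g2 : (forall z, D z -> g1 z = g2 z) ->
  Vint a D g1 = Vint a D g2.
Proof. by move=> e; apply: eq_integral => z /set_mem Dz; rewrite e. Qed.

Lemma le_Vint a D g1 g2 : measurable D ->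
  measurable_fun D g1 -> measurable_fun D g2 ->
  (forall z, D z -> 0 <= g1 z)%E -> (forall z, D z -> g1 z <= g2 z)%E ->
  (Vint a D g1 <= Vint a D g2)%E.
Proof.
move=> mD m1 m2 g0 g12; apply: ge0_le_integral => //.
- by move=> z Dz; rewrite mule_ge0 ?lee_fin ?powR_ge0 ?g0.
- exact: measurable_weighted.
- exact: measurable_weighted.
- by move=> z Dz; rewrite lee_wpmul2l ?lee_fin ?powR_ge0 ?g12.
Qed.

Lemma VintD a D g1 g2 : measurable D ->
  measurable_fun D g1 -> measurable_fun D g2 ->
  (forall z, D z -> 0 <= g1 z)%E -> (forall z, D z -> 0 <= g2 z)%E ->
  Vint a D (fun z => g1 z + g2 z)%E = (Vint a D g1 + Vint a D g2)%E.
Proof.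
move=> mD m1 m2 g10 g20; rewrite /Vint -ge0_integralD//.
- apply: eq_integral => z /set_mem Dz.
  by rewrite ge0_muleDr ?g10 ?g20.
- by move=> z Dz; rewrite mule_ge0 ?lee_fin ?powR_ge0 ?g10.
- exact: measurable_weighted.
- by move=> z Dz; rewrite mule_ge0 ?lee_fin ?powR_ge0 ?g20.
- exact: measurable_weighted.
Qed.

Lemma VintZl a D g (k : \bar R) : measurable D -> measurable_fun D g ->
  (forall z, D z -> 0 <= g z)%E -> (0 <= k)%E ->
  Vint a D (fun z => k * g z)%E = (k * Vint a D g)%E.
Proof.
move=> mD mg g0 k0; rewrite /Vint -ge0_integralZl//.
- by apply: eq_integral => z _; rewrite muleCA.
- exact: measurable_weighted.
- by move=> z Dz; rewrite mule_ge0 ?lee_fin ?powR_ge0 ?g0.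
Qed.

Lemma Vint_sum a D (I : Type) (s : seq I) (g : I -> R * R -> \bar R) :
  measurable D -> (forall i, measurable_fun D (g i)) ->
  (forall i z, D z -> 0 <= g i z)%E ->
  Vint a D (fun z => \sum_(i <- s) g i z)%E = (\sum_(i <- s) Vint a D (g i))%E.
Proof.
move=> mD mg g0; elim: s => [|i s ih].
  rewrite big_nil /Vint integral0_eq// => z _.
  by rewrite big_nil mule0.
rewrite big_cons -ih -VintD//.
- by apply: eq_Vint => z _; rewrite big_cons.
- exact: emeasurable_sum.
- exact: g0.
- by move=> z Dz; apply: sume_ge0 => j _; exact: g0.
Qed.

Lemma subset_Vint a A B g : measurable A -> measurable B -> A `<=` B ->
  measurable_fun B g -> (forall z, B z -> 0 <= g z)%E ->
  (Vint a A g <= Vint a B g)%E.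
Proof.
move=> mA mB AB mg g0; apply: ge0_subset_integral => //.
- exact: measurable_weighted.
- by move=> z Bz; rewrite mule_ge0 ?lee_fin ?powR_ge0 ?g0.
Qed.

Lemma Vint_indic a A B g : measurable A -> measurable B -> B `<=` A ->
  Vint a B g = Vint a A (fun z => (\1_B z)%:E * g z)%E.
Proof.
move=> mA mB BA; rewrite /Vint.
rewrite -{1}(setIidr BA) integral_mkcondr; apply: eq_integral => z _.
rewrite /patch indicE; case: (z \in B); first by rewrite mul1e.
by rewrite mul0e mule0.
Qed.

(** This superadditivity is all that [dyadic_packing] asks of a set function; the part of the box
    lying outside the two half-size boxes is simply dropped. *)
Lemma Vint_hbox_halves a (x l : R) g : 0 < l ->
  measurable_fun (@UHP R) g -> (forall z, UHP z -> 0 <= g z)%E ->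
  (Vint a (hbox (x, l / 2)%R) g + Vint a (hbox (x + l / 2, l / 2)%R) g
   <= Vint a (hbox (x, l)%R) g)%E.
Proof.
move=> l0 mg g0; have mg' D : D `<=` @UHP R -> measurable_fun D g.
  by move=> DU; apply: measurable_funS mg => //; exact: measurable_UHP.
have hU := hbox_sub_UHP.
rewrite /Vint -ge0_integral_setU//; try exact: measurable_hbox.
- apply: subset_Vint.
  + by apply: measurableU; exact: measurable_hbox.
  + exact: measurable_hbox.
  + by move=> [u v] [] [] /= /andP[? ?] /andP[? ?]; split=> /=; lra.
  + exact: mg'.
  + by move=> z hz; apply: g0; exact: hU hz.
- apply: measurable_weighted.
  + by apply: measurableU; exact: measurable_hbox.
  + by apply: mg'; rewrite subUset; split; exact: hU.
- by move=> z [] /hU hz; rewrite mule_ge0 ?lee_fin ?powR_ge0 ?g0.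
- rewrite disj_set2E; apply/eqP/seteqP; split => // -[u v] [] [] /= /andP[? ?] _ [] /= /andP[? ?] _.
  by lra.
Qed.

End weighted_integral.

(** * The volume of a box *)

Section box_measure.
Context {R : realType}.
Implicit Types a l : R.

Let cont_powR a (x : R) : 0 < x -> {for x, continuous ((@powR R)^~ a)}.
Proof.
move=> x0; apply: differentiable_continuous; apply/derivable1_diffP.
by apply: derivable_powR; rewrite in_itv/= x0.
Qed.

Lemma integral_powR_cc a (u l : R) : -1 < a -> 0 < u < l ->
  (\int[lebesgue_measure]_(x in `[u, l]) (x `^ a)%:E =
   ((l `^ (a + 1) - u `^ (a + 1)) / (a + 1))%:E)%E.
Proof.
move=> a1 /andP[u0 ul].
have s0 : a + 1 != 0 by rewrite gt_eqF; lra.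
pose F (x : R) := x `^ (a + 1) * (a + 1)^-1.
have dF (x : R) : 0 < x -> is_derive x 1 F (x `^ a).
  move=> x0; rewrite /F.
  have H := is_derive1_powR (a + 1) x0.
  have -> : x `^ a = (a + 1)^-1 *: ((a + 1) * x `^ (a + 1 - 1)).
    by rewrite addrK scalerAl /GRing.scale/= mulVf// mul1r.
  have -> : (fun x => x `^ (a + 1) / (a + 1)) = (a + 1)^-1 \*: (@powR R ^~ (a + 1)).
    by apply/funext => y /=; rewrite mulrC.
  exact: is_deriveZ.
have cF (x : R) : 0 < x -> {for x, continuous F}.
  move=> x0; apply: differentiable_continuous; apply/derivable1_diffP.
  by have [] := dF x x0.
rewrite (@continuous_FTC2 _ _ F) //.
- by rewrite -EFinB /F mulrBl.
- apply: continuous_in_subspaceT => x /set_mem /=; rewrite in_itv/= => /andP[ux _].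
  by apply: cont_powR; lra.
- split.
  + move=> x; rewrite in_itv/= => /andP[ux _].
    by have [] := dF x (lt_trans u0 ux).
  + by apply: cvg_at_right_filter; apply: cF.
  + by apply: cvg_at_left_filter; apply: cF; lra.
- move=> x; rewrite in_itv/= => /andP[ux _].
  by rewrite derive1E; have [_ ->] := dF x (lt_trans u0 ux).
Qed.

(** For negative [a] the integrand is unbounded at 0, so the fundamental theorem of calculus is
    applied on [[e n, l]] only, with [e n] decreasing to 0, and monotone convergence along these
    sets gives the limit. *)
Lemma integral_powR_oo a l : -1 < a -> 0 < l ->
  (\int[lebesgue_measure]_(x in `]0%R, l[) (x `^ a)%:E =
   (l `^ (a + 1) / (a + 1))%:E)%E.
Proof.
move=> a1 l0.
have mf D : measurable_fun D (fun x : R => (x `^ a)%:E).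
  by apply/measurable_EFinP; apply/measurable_funTS; exact: measurable_powR.
rewrite integral_itv_bndo_bndc//.
pose e : R^nat := geometric (l / 2) 2^-1.
have e0 n : 0 < e n by rewrite mulr_gt0 ?divr_gt0// exprn_gt0// invr_gt0.
have el n : e n < l.
  rewrite (@le_lt_trans _ _ (l / 2))//; last by lra.
  apply: ler_piMr; first by rewrite divr_ge0// ltW.
  by apply: exprn_ile1; lra.
have eD n m : (n <= m)%N -> e m <= e n.
  move=> nm; apply: ler_wpM2l; first by rewrite divr_ge0// ltW.
  by apply: ler_wiXn2l => //; lra.
have ecvg : e @ \oo --> (0 : R).
  by apply: cvg_geometric; rewrite ger0_norm ?invr_ge0// invf_lt1// ltr1n.
have Ucup : \bigcup_n `[e n, l]%classic = `]0, l]%classic.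
  apply/seteqP; split => x /=.
    move=> [n _] /=; rewrite !in_itv/= => /andP[ex ->]; rewrite andbT.
    exact: lt_le_trans ex.
  rewrite in_itv/= => /andP[x0 xl].
  have [N _ /(_ N (leqnn N))] : \forall n \near \oo, e n <= x.
    by apply: (cvgr_le 0) => //.
  by move=> /= eN; exists N => //=; rewrite in_itv/= eN.
have c1 : (\int[lebesgue_measure]_(x in `[e n, l]) (x `^ a)%:E)%E @[n --> \oo]
    --> (\int[lebesgue_measure]_(x in `]0%R, l]) (x `^ a)%:E)%E.
  rewrite -Ucup; apply: ge0_nondecreasing_set_cvg_integral.
  - move=> n m nm; apply/subsetPset => x /=; rewrite !in_itv/= => /andP[ex ->].
    by rewrite andbT (le_trans (eD _ _ nm)).
  - by move=> n; exact: measurable_itv.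
  - by move=> n; exact: mf.
  - by move=> n x _; rewrite lee_fin powR_ge0.
rewrite -(cvg_lim _ c1)//; apply: cvg_lim => //.
under eq_fun do rewrite integral_powR_cc// ?e0 ?el//.
apply: cvg_EFin; first by near=> n.
have -> : l `^ (a + 1) / (a + 1) = (l `^ (a + 1) - 0) / (a + 1) by rewrite subr0.
apply: cvgMl; apply: cvgB; first exact: cvg_cst.
have /cvg_at_rightP := @powR_cvg0 R (a + 1) ltac:(lra).
by apply; split.
Unshelve. all: by end_near. Qed.

Lemma Vmeas_Qbox a (x1 x2 : R) : -1 < a -> x1 < x2 ->
  Vmeas a (Qbox x1 x2) = ((a + 1)^-1 * (x2 - x1) `^ (2 + a))%:E.
Proof.
move=> a1 x12; have l0 : 0 < x2 - x1 by lra.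
rewrite /Vmeas /Vint QboxE integral_mkcond /leb2.
set f := (X in (\int[_]_x X x)%E).
have mf : measurable_fun setT f.
  apply/(measurable_restrictT _ _).1; first exact: measurableX.
  apply: (@measurable_weighted R a _ (fun=> 1%E)); first exact: measurableX.
  exact: measurable_cst.
have f0 z : (0 <= f z)%E.
  by apply: erestrict_ge0 => // u _; rewrite mule1 lee_fin powR_ge0.
rewrite fubini_tonelli1// /fubini_F.
pose J := ((x2 - x1) `^ (a + 1) / (a + 1)).
transitivity (\int[lebesgue_measure]_(x in `[x1, x2]) (cst J%:E x))%E.
  rewrite [RHS]integral_mkcond; apply: eq_integral => x _.
  rewrite /patch; case: ifPn => xI.
    rewrite -integral_powR_oo// [RHS]integral_mkcond; apply: eq_integral => y _.
    rewrite /f /patch; congr (if _ then _ else _); last by rewrite mule1.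
    by rewrite in_setX xI.
  apply: integral0_eq => y _.
  by rewrite /f /patch in_setX (negbTE xI).
rewrite integral_cst//= lebesgue_measure_itv/= lte_fin x12 -EFinB -EFinM.
congr _%:E.
have -> : (x2 - x1) `^ (2 + a) = (x2 - x1) `^ (a + 1) * (x2 - x1).
  rewrite -{3}(powRr1 (ltW l0)) -powRD; last by rewrite (gt_eqF l0) implybT.
  by congr (_ `^ _); lra.
by rewrite /J mulrA [_^-1 * _]mulrC.
Qed.

End box_measure.

(** * Dyadic trees of intervals and the packing inequality *)

Section dyadic_tree.
Context {R : realType}.
Implicit Types (a : R) (i j : R * R).

(** An interval is coded by its left endpoint and its length; [n] counts generations, so the
    shortest intervals have length [i.2 / 2 ^+ (n - 1)]. *)
Fixpoint dyadic (n : nat) i : seq (R * R) :=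
  if n is m.+1 then
    i :: dyadic m (i.1, i.2 / 2) ++ dyadic m (i.1 + i.2 / 2, i.2 / 2)
  else [::].

Lemma dyadic_gt0 n i j : 0 < i.2 -> j \in dyadic n i -> 0 < j.2.
Proof.
elim: n i => [//|n ih] i i0; rewrite /= inE mem_cat.
by case/or3P => [/eqP->//| |]; apply: ih => /=; lra.
Qed.

Lemma mem_dyadic n k m i : (k < n)%N -> (m < 2 ^ k)%N ->
  (i.1 + m%:R * (i.2 / 2 ^+ k), i.2 / 2 ^+ k) \in dyadic n i.
Proof.
elim: n k m i => [//|n ih] [|k] m [x l] /= kn.
  by rewrite expn0 ltnS leqn0 => /eqP ->; rewrite mul0r addr0 expr0 divr1 mem_head.
rewrite expnS => mk; rewrite inE mem_cat; apply/orP; right; apply/orP.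
have lE : l / 2 ^+ k.+1 = l / 2 / 2 ^+ k by rewrite exprS invfM mulrA.
have [mlt|mge] := ltnP m (2 ^ k).
  by left; have := ih k m (x, l / 2) kn mlt; rewrite /= lE.
right; have mk' : (m - 2 ^ k < 2 ^ k)%N by lia.
have := ih k (m - 2 ^ k)%N (x + l / 2, l / 2) kn mk'; rewrite /= lE.
suff -> : x + l / 2 + (m - 2 ^ k)%:R * (l / 2 / 2 ^+ k) = x + m%:R * (l / 2 / 2 ^+ k) by [].
rewrite natrB// natrX mulrBl; have -> : 2 ^+ k * (l / 2 / 2 ^+ k) = l / 2.
  by rewrite mulrC divfK// expf_neq0// pnatr_eq0.
by ring.
Qed.

Definition volume a (l : R) : R := (a + 1)^-1 * l `^ (2 + a).

(** The fraction of a box outside the boxes of its two halves: each of these has [2 ^ (-(2 + a))] of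
    the volume. It is positive precisely because [a > -1]. *)
Definition packing a : R := 1 - 2 `^ (- (a + 1)).

Lemma volume_gt0 a l : -1 < a -> 0 < l -> 0 < volume a l.
Proof. by move=> a1 l0; rewrite mulr_gt0 ?powR_gt0// invr_gt0; lra. Qed.

Lemma packing_gt0 a : -1 < a -> 0 < packing a.
Proof.
move=> a1; rewrite subr_gt0 powRN invf_lt1 ?powR_gt0//.
rewrite /powR pnatr_eq0/= -[ltLHS]expR0 ltr_expR mulr_gt0 ?ln_gt0 ?ltr1n//; lra.
Qed.

Lemma volume_halves a l : 0 <= l ->
  packing a * volume a l + (volume a (l / 2) + volume a (l / 2)) = volume a l.
Proof.
move=> l0; rewrite /volume powRM// ?invr_ge0//.
have -> : 2^-1 `^ (2 + a) = 2^-1 * 2 `^ (- (a + 1)) :> R.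
  rewrite -powR_inv1// -powRrM -powRD; last by rewrite pnatr_eq0 implybT.
  by congr (_ `^ _); lra.
by rewrite /packing; move: (2 `^ _) (l `^ _) (a + 1)^-1 => A B D; field.
Qed.

(** A stopping-time argument. Only the maximal intervals satisfying [P] are charged to [G], and they
    do not overlap; everything below such an interval is paid for by its own volume. *)
Lemma dyadic_packing a n i (P : pred (R * R)) (G : R * R -> \bar R) : -1 < a ->
  0 < i.2 -> (forall j, 0 <= G j)%E ->
  (forall x l : R, (0 < l)%R ->
     G (x, l / 2)%R + G (x + l / 2, l / 2)%R <= G (x, l)%R)%E ->
  (forall j, 0 < j.2 -> P j -> ((volume a j.2)%:E <= G j)%E) ->
  ((\sum_(j <- dyadic n i | P j) packing a * volume a j.2)%:E <= G i)%E.
Proof.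
move=> a1 + G0 Gadd GP.
(* The pieces of volume [packing a * volume a k.2] fit disjointly into the box of [j], so the sum
   telescopes through [volume_halves]. *)
have total m j : 0 < j.2 ->
    \sum_(k <- dyadic m j) packing a * volume a k.2 <= volume a j.2.
  elim: m j => [|m ih] j j0.
    by rewrite big_nil ltW// volume_gt0.
  rewrite /= big_cons big_cat/= -[leRHS](volume_halves a (ltW j0)) lerD2l.
  by rewrite lerD// (le_trans (ih _ _))//=; lra.
elim: n i => [|n ih] [x l] /= i0; first by rewrite big_nil.
(* At a chosen interval the recursion stops: its whole subtree is bounded by [total], whether or not
   the descendants satisfy [P]. Otherwise superadditivity passes [G] on to the halves. *)
have [Pi|nPi] := boolP (P (x, l)).
  apply: le_trans (GP (x, l) i0 Pi); rewrite lee_fin; apply: le_trans (total n.+1 (x, l) i0).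
  rewrite /= big_mkcond/= !big_cons !big_cat/= Pi lerD2l.
  have le s : all (fun k => 0 < k.2) s ->
      \sum_(k <- s) (if P k then packing a * volume a k.2 else 0) <=
      \sum_(k <- s) packing a * volume a k.2.
    move=> /allP s0; rewrite big_seq [leRHS]big_seq; apply: ler_sum => k ks.
    case: ifP => // _; rewrite mulr_ge0 ?ltW ?packing_gt0 ?volume_gt0//.
    exact: s0.
  by apply: lerD; apply: le; apply/allP => k; apply: dyadic_gt0 => /=; lra.
rewrite /= big_cons (negbTE nPi) big_cat/= EFinD.
by apply: le_trans (Gadd _ _ i0); rewrite leeD ?ih//=; lra.
Qed.

End dyadic_tree.

(** * Young functions and the [B_r] condition *)

Section young_functions.
Context {R : realType}.
Implicit Types Phi Theta : R -> R.

Lemma Young_le Phi (s t : R) : Young Phi -> 0 <= s -> s <= t -> Phi s <= Phi t.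
Proof. by move=> [_ [_ [h _]]]; exact: h. Qed.

Lemma Young_ge0 Phi (t : R) : Young Phi -> 0 <= t -> 0 <= Phi t.
Proof. by move=> [_ [_ [_ [h _]]]]; exact: h. Qed.

Lemma Young0 Phi : Young Phi -> Phi 0 = 0.
Proof. by move=> [_ [_ [_ [_ []]]]]. Qed.

Lemma Young_scale Phi (l t : R) : Young Phi -> 0 <= l <= 1 -> 0 <= t ->
  Phi (l * t) <= l * Phi t.
Proof.
move=> yP l01 t0; have [_ [cvx _]] := yP.
have := cvx 0 t l (lexx 0) t0 l01.
by rewrite (Young0 yP) !mulr0 !add0r.
Qed.

(** [Young] does not constrain [Phi] at negative arguments; precomposing with [Num.max 0] yields a
    function that is monotone on the whole line. *)
Lemma Young_measurable d (T : measurableType d) Phi (D : set T) (u : T -> R) :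
  Young Phi -> measurable D -> measurable_fun D u ->
  (forall z, D z -> 0 <= u z) -> measurable_fun D (fun z => Phi (u z)).
Proof.
move=> yP mD mu u0.
apply: (eq_measurable_fun (fun z => (Phi \o Num.max 0) (u z))).
  by move=> z /set_mem Dz /=; rewrite max_r// u0.
apply: (measurableT_comp (f := Phi \o Num.max 0)) => //.
apply: nondecreasing_measurable => // x y xy /=; apply: Young_le => //.
  by rewrite le_max lexx.
by rewrite ge_max !le_max lexx/= xy orbT.
Qed.

Lemma measurable_inv_ge0 d (T : measurableType d) (D : set T) (u : T -> R) :
  measurable D -> measurable_fun D u -> (forall z, D z -> 0 <= u z) ->
  measurable_fun D (fun z => (u z)^-1).
Proof.
move=> mD mu u0; apply: (eq_measurable_fun (fun z => u z `^ (-1))).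
  by move=> z /set_mem Dz; rewrite powR_inv1// u0.
exact: (measurableT_comp (measurable_powR (-1))).
Qed.

Let W Theta (r : R) (t : R) : \bar R := (Theta t / t `^ r / t)%:E.

Let measurable_W Theta r (s : R) (D : set R) : Young Theta -> 0 < s ->
  measurable D -> (forall t, D t -> s <= t) -> measurable_fun D (W Theta r).
Proof.
move=> yT s0 mD Ds; apply/measurable_EFinP.
have t0 t : D t -> 0 <= t by move=> /Ds; exact/le_trans/ltW.
apply: measurable_funM; last first.
  by apply: measurable_inv_ge0 => //; exact: measurable_funTS.
apply: measurable_funM; first exact: Young_measurable.
apply: measurable_inv_ge0 => //; last by move=> t _; exact: powR_ge0.
by apply/measurable_funTS; exact: measurable_powR.
Qed.

(** On [[s, 2 * s[] the integrand is at least [Theta s / (2 * s) ^ r / (2 * s)], and the interval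
    has length [s]; this is the origin of [2 ^ (r + 1)]. The induction peels off one such block at a
    time. *)
Lemma Bclass_dyadic_sum Theta (r s : R) N : Young Theta -> 0 < r -> 0 < s ->
  ((\sum_(n < N) Theta (2 ^+ n * s) / (2 ^+ n * s) `^ r)%:E <=
   (2 `^ (r + 1))%:E *
   \int[lebesgue_measure]_(t in [set t | (s <= t)%R]) (Theta t / t `^ r / t)%:E)%E.
Proof.
move=> yT r0; rewrite -/(W Theta r).
have itvE (x : R) : [set t | (x <= t)%R] = `[x, +oo[%classic.
  by apply/seteqP; split => t /=; rewrite in_itv/= andbT.
have Wge0 (x t : R) : 0 < x -> x <= t -> (0 <= W Theta r t)%E.
  move=> x0 xt; have t0 := lt_le_trans x0 xt.
  by rewrite lee_fin !divr_ge0 ?powR_ge0 ?(ltW t0) ?(Young_ge0 yT) ?ltW.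
elim: N s => [|N ih] s s0.
  rewrite big_ord0 mule_ge0 ?lee_fin ?powR_ge0//.
  by apply: integral_ge0 => t /= st; exact: Wge0 st.
rewrite big_ord_recl expr0 mul1r EFinD.
have -> : \sum_(i < N) Theta (2 ^+ bump 0 i * s) / (2 ^+ bump 0 i * s) `^ r =
    \sum_(i < N) Theta (2 ^+ i * (2 * s)) / (2 ^+ i * (2 * s)) `^ r.
  by apply: eq_bigr => i _; rewrite /bump add1n exprSr mulrA.
have s20 : 0 < 2 * s by lra.
apply: le_trans (leeD (lexx _) (ih _ s20)) _.
have -> : [set t | (s <= t)%R] = `[s, 2 * s[%classic `|` [set t | (2 * s <= t)%R].
  apply/seteqP; split => t /=; rewrite in_itv/=.
    by move=> ->/=; case: ltP; [left|right].
  by case=> [/andP[]//|]; lra.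
rewrite ge0_integral_setU//; last first.
- rewrite disj_set2E; apply/eqP/seteqP; split => // t /= [].
  by rewrite in_itv/= => /andP[_ ?]; rewrite leNgt => /negP.
- move=> t [/=|/= h]; last exact: Wge0 s20 h.
  by rewrite in_itv/= => /andP[h _]; exact: Wge0 s0 h.
- apply: (measurable_W _ _ s0) => //.
    by apply: measurableU => //; rewrite itvE.
  by move=> t [/=|/=]; [rewrite in_itv/= => /andP[]|lra].
- by rewrite itvE.
have [Ige0 I2ge0] : (0 <= \int[lebesgue_measure]_(t in `[s, (2 * s)%R[) W Theta r t)%E
   /\ (0 <= \int[lebesgue_measure]_(t in [set t | (2 * s <= t)%R]) W Theta r t)%E.
  split; apply: integral_ge0 => t /=; last exact: Wge0.
  by rewrite in_itv/= => /andP[h _]; exact: Wge0 s0 h.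
rewrite (ge0_muleDr _ Ige0 I2ge0); apply: leeD => //.
pose k := Theta s / (2 * s) `^ r / (2 * s).
have : (\int[lebesgue_measure]_(t in `[s, (2 * s)%R[) (cst k%:E t) <=
        \int[lebesgue_measure]_(t in `[s, (2 * s)%R[) W Theta r t)%E.
  apply: ge0_le_integral => //.
  - by move=> t _; rewrite lee_fin /k !divr_ge0 ?powR_ge0 ?(Young_ge0 yT) ?ltW.
  - by apply: (measurable_W _ _ s0) => // t /=; rewrite in_itv/= => /andP[].
  - move=> t /=; rewrite in_itv/= => /andP[st t2]; rewrite lee_fin /k.
    have t0 : 0 < t by exact: lt_le_trans st.
    have Ts0 : 0 <= Theta s by rewrite (Young_ge0 yT) ?ltW.
    have s2r0 : 0 < (2 * s) `^ r by rewrite powR_gt0.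
    apply: ler_pM.
    + by rewrite divr_ge0// ltW.
    + by rewrite invr_ge0 ltW.
    + apply: ler_pM => //; first by rewrite invr_ge0 ltW.
        by apply: Young_le => //; exact: ltW.
      by rewrite lef_pV2 ?posrE ?powR_gt0// ge0_ler_powR ?nnegrE ?(ltW t0) ?(ltW t2) ?(ltW r0) ?(ltW s20).
    + by rewrite lef_pV2 ?posrE ?(ltW t2).
rewrite integral_cst//= lebesgue_measure_itv/= lte_fin.
have -> : s < 2 * s by lra.
move=> H; apply: le_trans (lee_wpmul2l _ H); last by rewrite lee_fin powR_ge0.
rewrite -EFinB -!EFinM lee_fin /k powRM ?(ltW s0)// powRD ?pnatr_eq0 ?implybT//.
rewrite powRr1//; have := powR_gt0 r (ltr0Sn R 1); have := powR_gt0 r s0.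
move: (s `^ r) (2 `^ r) (Theta s) => A B D A0 B0.
rewrite [leRHS](_ : _ = D / A)//.
by field; rewrite !gt_eqF.
Qed.

(* Small arguments are harmless because [Theta x <= 1/2] for [x <= e]; monotonicity
   lets the remaining range be rescaled into the domain [c <= t] where the
   integral of the [B_class] condition converges. *)
Lemma Bclass_truncated_sum Theta (r : R) : 1 < r -> B_class r Theta ->
  exists e K : R, [/\ 0 < e, Theta e <= 2^-1, 0 < K &
    forall N (x t : R), 0 <= x -> 0 < t ->
      \sum_(n < N) (2 * (t / 2 ^+ n)) `^ r *
        (if e * (t / 2 ^+ n) < x then Theta (x / (t / 2 ^+ n)) else 0)
      <= K * x `^ r].
Proof.
move=> r1 [yT _ [c [c0 cint]]].
have r0 : 0 < r by lra.
have T1 := Young_ge0 yT ler01.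
(* The bound 1 permits scaling by convexity, [c] makes [k = c / e] at least 1, and the last entry
   turns [Theta e <= e * Theta 1] into [Theta e <= 1/2]. *)
pose e : R := Num.min (Num.min 1 c) (2 * (Theta 1 + 1))^-1.
have e0 : 0 < e by rewrite !lt_min ltr01 c0 invr_gt0; lra.
have e1 : e <= 1 by rewrite !ge_min lexx.
have ec : e <= c by rewrite !ge_min lexx orbT.
have eT : e <= (2 * (Theta 1 + 1))^-1 by rewrite ge_min lexx orbT.
have Te : Theta e <= 2^-1.
  have := @Young_scale Theta e 1 yT; rewrite mulr1 (ltW e0) e1 => /(_ isT ler01).
  move=> /le_trans; apply; apply: le_trans (ler_wpM2r T1 eT) _.
  by rewrite ler_pdivrMl; lra.
set I := (\int[_]_(_ in _) _)%E in cint.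
have I0 : (0 <= I)%E.
  apply: integral_ge0 => t /= ct; have t0 := lt_le_trans c0 ct.
  by rewrite lee_fin !divr_ge0 ?powR_ge0 ?(ltW t0) ?(Young_ge0 yT) ?ltW.
have If : I \is a fin_num by rewrite ge0_fin_numE.
pose k := c / e.
have k1 : 1 <= k by rewrite ler_pdivlMr// mul1r.
have ck y : e < y -> c <= k * y.
  by move=> ey; rewrite /k mulrAC ler_pdivlMr// ler_wpM2l ?(ltW c0)// ltW.
clearbody k.
pose K0 := 2 `^ (r + 1) * fine I.
have K00 : 0 <= K0 by rewrite mulr_ge0 ?powR_ge0 ?fine_ge0.
have sumc N (s : R) : c <= s ->
    \sum_(n < N) Theta (2 ^+ n * s) / (2 ^+ n * s) `^ r <= K0.
  move=> cs; have s0 := lt_le_trans c0 cs.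
  rewrite -lee_fin EFinM fineK//.
  apply: le_trans (Bclass_dyadic_sum N yT r0 s0) _.
  rewrite lee_wpmul2l ?lee_fin ?powR_ge0//.
  have itvE (x : R) : [set t | (x <= t)%R] = `[x, +oo[%classic.
    by apply/seteqP; split => t /=; rewrite in_itv/= andbT.
  rewrite /I !itvE; apply: ge0_subset_integral => //.
  - by apply: (measurable_W _ _ c0) => // t /=; rewrite in_itv/= andbT.
  - move=> t /=; rewrite in_itv/= andbT => ct; have t0 := lt_le_trans c0 ct.
    by rewrite lee_fin !divr_ge0 ?powR_ge0 ?(ltW t0) ?(Young_ge0 yT) ?ltW.
  - by move=> t /=; rewrite !in_itv/= !andbT; exact: le_trans.
exists e, (2 `^ r * k `^ r * (K0 + 1)); split => //.
  by rewrite !mulr_gt0 ?powR_gt0//; lra.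
elim=> [|N ih] x t x0 t0.
  by rewrite big_ord0 !mulr_ge0 ?powR_ge0//; lra.
(* While [x <= e * t] the leading term vanishes and the sum restarts at [t / 2]. Once [e * t < x],
   the point [k * (x / t)] exceeds [c], and all remaining terms are compared with the sum [sumc]
   started there. *)
have [ext|] := ltP (e * t) x; last first.
  move=> xe; rewrite big_ord_recl expr0 divr1 ltNge xe/= mulr0 add0r.
  rewrite (_ : (\sum_(i < N) _)%R = \sum_(n < N) (2 * (t / 2 / 2 ^+ n)) `^ r *
        (if e * (t / 2 / 2 ^+ n) < x then Theta (x / (t / 2 / 2 ^+ n)) else 0)).
    by apply: ih => //; lra.
  apply: eq_bigr => i _; rewrite /bump add1n.
  by have -> : t / 2 ^+ i.+1 = t / 2 / 2 ^+ i by rewrite exprS invfM mulrA.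
have x0' : 0 < x by apply: lt_trans ext; rewrite mulr_gt0.
apply: (@le_trans _ _ (2 `^ r * k `^ r * x `^ r *
   \sum_(n < N.+1) Theta (2 ^+ n * (k * (x / t))) / (2 ^+ n * (k * (x / t))) `^ r)).
  rewrite mulr_sumr; apply: ler_sum => n _.
  have p0 : 0 < 2 ^+ n :> R by rewrite exprn_gt0.
  have xt0 : 0 < x / t by rewrite divr_gt0.
  have k0 : 0 < k by lra.
  have -> : x / (t / 2 ^+ n) = 2 ^+ n * (x / t) by rewrite invfM invrK; ring.
  have -> : 2 * (t / 2 ^+ n) = 2 * (x / (2 ^+ n * (x / t))).
    by field; rewrite !gt_eqF.
  have s0 : 0 < 2 ^+ n * (x / t) by rewrite mulr_gt0.
  have -> : 2 ^+ n * (k * (x / t)) = k * (2 ^+ n * (x / t)) by ring.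
  move: (2 ^+ n * (x / t)) s0 => s s0.
  rewrite !powRM ?mulr_ge0 ?invr_ge0 ?(ltW s0) ?(ltW k0) ?(ltW x0')//.
  have sV : s^-1 `^ r = (s `^ r)^-1 by rewrite -powR_inv1 ?(ltW s0)// -powRrM mulN1r powRN.
  rewrite sV.
  have A0 := powR_gt0 r s0; have k0r := powR_gt0 r k0.
  rewrite [leRHS](_ : _ = 2 `^ r * (x `^ r / s `^ r) * Theta (k * s)); last first.
    by field; rewrite !gt_eqF.
  rewrite ler_wpM2l ?mulr_ge0 ?invr_ge0 ?powR_ge0//.
  have Tle : Theta s <= Theta (k * s) by apply: Young_le => //; [lra|rewrite ler_peMl// ltW].
  by case: ifP => // _; apply: le_trans Tle; rewrite Young_ge0// ltW.
rewrite mulrAC ler_wpM2r ?powR_ge0// ler_wpM2l ?mulr_ge0 ?powR_ge0//.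
apply: le_trans (sumc _ _ _) _; last by lra.
by apply: ck; rewrite ltr_pdivlMr.
Qed.

End young_functions.

(** * Orlicz norms on boxes *)

Section orlicz.
Context {R : realType}.
Implicit Types (Theta : R -> R) (F : R * R -> R) (i : R * R).

Definition modular (a : R) Theta F i (m : R) : \bar R :=
  Vint a (hbox i) (fun z => (Theta (F z / m))%:E).

(* The Luxemburg norm of [F >= 0], with the average written as a comparison with the
   volume of the box; [inf set0 = 0] when no [m] is admissible. *)
Definition orlicz_norm (a : R) Theta F i : R :=
  inf [set m : R | 0 < m /\ (modular a Theta F i m <= (volume a i.2)%:E)%E].

Let norm_lb (a : R) Theta F i :
  lbound [set m : R | 0 < m /\ (modular a Theta F i m <= (volume a i.2)%:E)%E] 0.
Proof. by move=> m [/ltW]. Qed.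

Lemma orlicz_norm_ge0 a Theta F i : 0 <= orlicz_norm a Theta F i.
Proof.
rewrite /orlicz_norm; set S := [set m | _].
have [->|/set0P S0] := eqVneq S set0; first by rewrite inf0.
by apply: lb_le_inf => //; exact: norm_lb.
Qed.

Lemma lt_orlicz_norm a Theta F i (m : R) : 0 < m -> m < orlicz_norm a Theta F i ->
  ((volume a i.2)%:E < modular a Theta F i m)%E.
Proof.
move=> m0 mn; rewrite ltNge; apply/negP => le; move: mn; apply/negP; rewrite -leNgt.
by apply: ge_inf => //; exists 0; exact: norm_lb.
Qed.

Lemma Vint_hbox1_le a i : -1 < a -> 0 < i.2 ->
  (Vint a (hbox i) (fun=> 1) <= (volume a i.2)%:E)%E.
Proof.
case: i => x l /= a1 l0; have -> : volume a l = volume a (x + l - x) by congr volume; lra.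
rewrite -Vmeas_Qbox//; last by lra.
apply: subset_Vint => //; [exact: measurable_hbox|exact: measurable_Qbox|].
move=> z [/= /andP[h1 h2] /andP[h3 h4]]; split; first by rewrite h1 ltW.
by rewrite h3/=; lra.
Qed.

Section modular_theory.
Variables (a : R) (Theta : R -> R) (F : R * R -> R).
Hypotheses (a1 : -1 < a) (yT : Young Theta) (mF : measurable_fun (@UHP R) F).
Hypothesis F0 : forall z, UHP z -> 0 <= F z.

Let measurable_scaled (m : R) : 0 < m ->
  measurable_fun (@UHP R) (fun z => Theta (F z / m)).
Proof.
move=> m0; apply: Young_measurable => //; first exact: measurable_UHP.
  by apply: measurable_funM => //; exact: measurable_cst.
by move=> z Uz; rewrite divr_ge0 ?F0// ltW.
Qed.

Lemma measurable_modular (m : R) i : 0 < m ->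
  measurable_fun (hbox i) (fun z => (Theta (F z / m))%:E).
Proof.
move=> m0; apply/measurable_EFinP.
by apply: measurable_funS (measurable_scaled m0); [exact: measurable_UHP|exact: hbox_sub_UHP].
Qed.

Lemma modular_anti (m m' : R) i : 0 < m -> m <= m' ->
  (modular a Theta F i m' <= modular a Theta F i m)%E.
Proof.
move=> m0 mm'; have m'0 := lt_le_trans m0 mm'.
have hU := @hbox_sub_UHP R i.
apply: le_Vint; [exact: measurable_hbox|exact: measurable_modular|exact: measurable_modular| |].
  by move=> z /hU/F0 Fz; rewrite lee_fin (Young_ge0 yT)// divr_ge0// ltW.
move=> z /hU/F0 Fz; rewrite lee_fin; apply: Young_le => //.
  by rewrite divr_ge0// ltW.
by rewrite ler_wpM2l// lef_pV2.
Qed.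

(** The admissible value [m1] excludes the default value of the infimum of the empty set; then some
    admissible [m'] lies below [m], and [modular_anti] transfers the bound to [m]. *)
Lemma gt_orlicz_norm (m m1 : R) i : 0 < m1 ->
  (modular a Theta F i m1 <= (volume a i.2)%:E)%E ->
  orlicz_norm a Theta F i < m -> (modular a Theta F i m <= (volume a i.2)%:E)%E.
Proof.
move=> m10 H1 nm.
have [|m' [m'0 H'] m'm] := @inf_lt _ _ m _ nm; first by exists m1; split.
by apply: le_trans H'; apply: modular_anti => //; exact: ltW.
Qed.

(** The cut at [e * m] discards small values of [F / m]: [Theta] may be linear near 0, and the sum
    over levels [m] of [m ^ r * Theta (F / m)] would then be unbounded as the top level grows. *)
Definition trunc (e m : R) (z : R * R) : R :=
  if e * m < F z then Theta (F z / m) else 0.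

Lemma trunc_ge0 e m z : 0 < m -> UHP z -> 0 <= trunc e m z.
Proof.
by move=> m0 Uz; rewrite /trunc; case: ifP => // _; rewrite (Young_ge0 yT)// divr_ge0 ?F0 ?ltW.
Qed.

Lemma measurable_trunc e m : 0 < m -> measurable_fun (@UHP R) (trunc e m).
Proof.
move=> m0; apply: measurable_fun_if; first exact: measurable_UHP.
- by apply: measurable_fun_ltr => //; exact: measurable_cst.
- by apply: measurable_funS (measurable_scaled m0); [exact: measurable_UHP|exact: subIsetl].
- exact: measurable_cst.
Qed.

(** Where [F <= e * m] the integrand of the modular is at most 1/2, so that part contributes at most
    half the volume and is absorbed on the left; this costs the factor 2. *)
Lemma volume_le_trunc e m i : 0 < i.2 -> 0 < e -> Theta e <= 2^-1 ->
  0 < m -> m < orlicz_norm a Theta F i ->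
  ((volume a i.2)%:E <= 2%:E * Vint a (hbox i) (fun z => (trunc e m z)%:E))%E.
Proof.
move=> i0 e0 Te m0 /(lt_orlicz_norm m0) V.
have hU := @hbox_sub_UHP R i.
have mt : measurable_fun (hbox i) (fun z => (trunc e m z)%:E).
  apply/measurable_EFinP.
  by apply: measurable_funS (measurable_trunc e m0); [exact: measurable_UHP|].
have : (modular a Theta F i m <= (2^-1)%:E * (volume a i.2)%:E +
   Vint a (hbox i) (fun z => (trunc e m z)%:E))%E.
  apply: (@le_trans _ _ (Vint a (hbox i) (fun z => (2^-1)%:E * (1 : \bar R) + (trunc e m z)%:E)%E)).
    apply: le_Vint; [exact: measurable_hbox|exact: measurable_modular| | |].
    - by apply: emeasurable_funD => //; exact: measurable_cst.
    - by move=> z /hU/F0 Fz; rewrite lee_fin (Young_ge0 yT)// divr_ge0// ltW.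
    - move=> z /hU/F0 Fz; rewrite mule1 -EFinD lee_fin /trunc; case: ltP => [_|h].
        by rewrite lerDr.
      rewrite addr0; apply: le_trans Te; apply: Young_le => //.
        by rewrite divr_ge0// ltW.
      by rewrite ler_pdivrMr.
  rewrite VintD; [|exact: measurable_hbox|exact: measurable_cst|exact: mt| |]; first last.
  - by move=> z /hU Uz; rewrite lee_fin trunc_ge0.
  - by move=> z _; rewrite mule1 lee_fin.
  apply: leeD => //; rewrite VintZl//; last exact: measurable_hbox.
  by rewrite lee_wpmul2l ?lee_fin ?invr_ge0// Vint_hbox1_le.
move=> /(lt_le_trans V).
have := @Vint_ge0 R a (hbox i) (fun z => (trunc e m z)%:E).
move=> /(_ (fun z h => trunc_ge0 e m0 (hU z h))).
case: (Vint _ _ _) => [G| |]//.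
  by rewrite -!EFinM -EFinD !lee_fin lte_fin; lra.
by rewrite gt0_muley ?leey// lte_fin.
Qed.

(** Provides the admissible value that [gt_orlicz_norm] and [orlicz_holder] require: for [F] in
    [L^r] the norm is a genuine infimum. *)
Lemma orlicz_norm_fin (r : R) i : 0 < i.2 -> 1 < r -> B_class r Theta ->
  (Vint a (@UHP R) (fun z => (F z `^ r)%:E) < +oo)%E ->
  exists m, 0 < m /\ (modular a Theta F i m <= (volume a i.2)%:E)%E.
Proof.
move=> i0 r1 bT; set J := Vint _ _ _ => Joo.
have hU := @hbox_sub_UHP R i.
have J0 : (0 <= J)%E by apply: Vint_ge0 => z _; rewrite lee_fin powR_ge0.
have [e [K [e0 Te K0 HK]]] := Bclass_truncated_sum r1 bT.
have v0 := volume_gt0 a1 i0.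
(* The one-term case, at level 1, of the truncated sum already gives growth of order at most
   [x ^ r]. *)
have Tle x : 0 <= x -> Theta x <= 2^-1 + K * x `^ r.
  move=> x0; have := HK 1%N x 1 x0 ltr01.
  rewrite big_ord1 expr0 divr1 !mulr1 divr1; case: ltP => [_|xe _].
    have : 1 <= 2 `^ r :> R by rewrite -[leLHS](powRr0 (2 : R)) ler_powR ?ler1n//; lra.
    by have := Young_ge0 yT x0; nra.
  have := @Young_le R Theta x e yT x0 xe.
  by have := powR_ge0 x r; nra.
(* Chosen so that [K / m * fine J] is at most half the volume; the summand 1 ensures
   [m <= m ^ r]. *)
pose m := 1 + 2 * K * fine J / volume a i.2.
have fJ0 : 0 <= fine J by rewrite fine_ge0.
have m1 : 1 <= m by rewrite lerDl !mulr_ge0 ?invr_ge0 ?(ltW v0) ?(ltW K0).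
have m0 : 0 < m by lra.
have mmr : m <= m `^ r by rewrite le1r_powR// ltW.
exists m; split => //.
have mFr : measurable_fun (@UHP R) (fun z => (F z `^ r)%:E).
  by apply/measurable_EFinP; exact: (measurableT_comp (measurable_powR r)).
have mFh : measurable_fun (hbox i) (fun z => (F z `^ r)%:E).
  by apply: measurable_funS mFr; [exact: measurable_UHP|].
apply: (@le_trans _ _ (Vint a (hbox i)
   (fun z => (2^-1)%:E * (1 : \bar R) + (K / m `^ r)%:E * (F z `^ r)%:E)%E)).
  apply: le_Vint; [exact: measurable_hbox|exact: measurable_modular| | |].
  - apply: emeasurable_funD; first exact: measurable_cst.
    by apply: emeasurable_funM => //; exact: measurable_cst.
  - by move=> z /hU/F0 Fz; rewrite lee_fin (Young_ge0 yT)// divr_ge0// ltW.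
  - move=> z /hU/F0 Fz; rewrite mule1 -EFinM -EFinD lee_fin.
    apply: le_trans (Tle _ _) _; first by rewrite divr_ge0// ltW.
    rewrite powRM ?invr_ge0 ?(ltW m0)// -(powR_inv1 (ltW m0)) -powRrM mulN1r powRN.
    by rewrite lerD2l -mulrA [_^-1 * _]mulrC.
have Km0 : 0 <= K / m `^ r by rewrite divr_ge0 ?powR_ge0// ltW.
rewrite VintD; [|exact: measurable_hbox|exact: measurable_cst| | |]; first last.
- by move=> z _; rewrite mule_ge0 ?lee_fin ?powR_ge0.
- by move=> z _; rewrite mule1 lee_fin.
- by apply: emeasurable_funM => //; exact: measurable_cst.
rewrite VintZl//; last exact: measurable_hbox.
rewrite VintZl//; [|exact: measurable_hbox|by move=> z _; rewrite lee_fin powR_ge0].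
have JE : J = (fine J)%:E by rewrite fineK// ge0_fin_numE.
apply: (@le_trans _ _ ((2^-1)%:E * (volume a i.2)%:E + (K / m `^ r)%:E * (fine J)%:E)%E).
  apply: leeD; first by rewrite lee_wpmul2l ?lee_fin ?invr_ge0// Vint_hbox1_le.
  rewrite lee_wpmul2l ?lee_fin// -JE; apply: subset_Vint => //.
  - exact: measurable_hbox.
  - exact: measurable_UHP.
  - by move=> z _; rewrite lee_fin powR_ge0.
rewrite -!EFinM -EFinD lee_fin.
have : K / m `^ r * fine J <= K / m * fine J.
  rewrite ler_wpM2r// ler_wpM2l ?(ltW K0)// lef_pV2 ?posrE//.
  exact: lt_le_trans mmr.
have : K / m * fine J <= volume a i.2 / 2.
  rewrite mulrAC ler_pdivrMr// /m mulrDr mulr1.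
  rewrite [X in _ + X](_ : _ = K * fine J); last by field; rewrite gt_eqF.
  by lra.
by lra.
Qed.

End modular_theory.
End orlicz.

(** * Carleson embedding for Orlicz norms *)

Section carleson.
Context {R : realType}.
Implicit Types (Theta : R -> R) (F : R * R -> R) (i : R * R).

(** A discrete layer-cake formula: the largest level [t / 2 ^+ n] below [lam] is at least [lam / 2],
    so its single term already dominates. *)
Lemma dyadic_levels (lam t r : R) : 0 < r -> 0 < t -> 0 <= lam -> lam <= 2 * t ->
  exists N, forall M, (N <= M)%N ->
    lam `^ r <= \sum_(n < M | t / 2 ^+ n < lam) (2 * (t / 2 ^+ n)) `^ r.
Proof.
move=> r0 t0; rewrite le_eqVlt => /predU1P[<- _|lam0 lt].
  exists 0%N => M _; rewrite powR0 ?gt_eqF//.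
  by apply: sumr_ge0 => n _; exact: powR_ge0.
have exn : exists n, t / 2 ^+ n < lam.
  exists (Num.bound (t / lam)); rewrite ltr_pdivrMr ?exprn_gt0// mulrC -ltr_pdivrMr//.
  apply: (@lt_le_trans _ _ (Num.bound (t / lam))%:R).
    by rewrite archi_boundP// divr_ge0// ltW.
  by rewrite -natrX ler_nat ltnW// ltn_expl.
case: (ex_minnP exn) => n tn nmin; exists n.+1 => M nM.
rewrite (bigD1 (Ordinal nM))//=.
have le : lam <= 2 * (t / 2 ^+ n).
  case: n tn nmin nM => [|n] tn nmin nM; first by rewrite expr0 divr1.
  rewrite leNgt; apply/negP => h.
  have /nmin : t / 2 ^+ n < lam by apply: le_lt_trans h; rewrite exprS invfM; lra.
  by rewrite ltnn.
apply: (@le_trans _ _ ((2 * (t / 2 ^+ n)) `^ r)).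
  by rewrite ge0_ler_powR ?nnegrE ?(ltW r0) ?(ltW lam0)// (le_trans (ltW lam0)).
by rewrite lerDl; apply: sumr_ge0 => k _; exact: powR_ge0.
Qed.

Lemma dyadic_levels_seq (s : seq (R * R)) (lam : R * R -> R) (t r : R) :
  0 < r -> 0 < t -> (forall j, 0 <= lam j) ->
  (forall j, j \in s -> lam j <= 2 * t) ->
  exists N, forall j, j \in s ->
    lam j `^ r <= \sum_(n < N | t / 2 ^+ n < lam j) (2 * (t / 2 ^+ n)) `^ r.
Proof.
move=> r0 t0 lam0 lt.
(* Asking for every [M >= N] lets the finitely many thresholds be merged by a maximum. *)
suff [N HN] : exists N, forall j M, j \in s -> (N <= M)%N ->
    lam j `^ r <= \sum_(n < M | t / 2 ^+ n < lam j) (2 * (t / 2 ^+ n)) `^ r.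
  by exists N => j js; exact: HN.
elim: s lt => [|k s ih] lt; first by exists 0%N.
have [|N HN] := ih; first by move=> j js; apply: lt; rewrite inE js orbT.
have [N' HN'] := dyadic_levels r0 t0 (lam0 k) (lt k (mem_head _ _)).
exists (maxn N N') => j M; rewrite inE geq_max => /predU1P[->|js] /andP[NM N'M].
  exact: HN'.
exact: HN.
Qed.

(** In the constant, 2 comes from [volume_le_trunc], [K] from the sum over levels and [packing a]
    from the tree. It depends on neither [n] nor [i], as the passage to growing grids requires. *)
Lemma orlicz_carleson (a r : R) Theta : -1 < a -> 1 < r -> B_class r Theta ->
  exists K : R, 0 < K /\ forall F, measurable_fun (@UHP R) F ->
    (forall z, UHP z -> 0 <= F z) ->
    forall n i, 0 < i.2 ->
    ((\sum_(j <- dyadic n i) volume a j.2 * orlicz_norm a Theta F j `^ r)%:E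
     <= K%:E * Vint a (@UHP R) (fun z => (F z `^ r)%:E))%E.
Proof.
move=> a1 r1 bT; have [yT _ _] := bT; have r0 : 0 < r by lra.
have [e [K [e0 Te K0 HK]]] := Bclass_truncated_sum r1 bT.
have c0 := packing_gt0 a1.
exists (2 * K / packing a); split; first by rewrite divr_gt0 ?mulr_gt0.
move=> F mF F0 n i i0.
pose lam := orlicz_norm a Theta F.
have lam0 j : 0 <= lam j by exact: orlicz_norm_ge0.
set s := dyadic n i.
(* A top level above all the norms on this tree. Its size is harmless, since [HK] is uniform in
   [t]. *)
pose t := 1 + \sum_(j <- s) lam j.
have t0 : 0 < t by rewrite ltr_wpDr// sumr_ge0.
have lt j : j \in s -> lam j <= 2 * t.
  move=> js; rewrite /t (big_rem j)//=.
  have := lam0 j; have : 0 <= \sum_(y <- rem j s) lam y by exact: sumr_ge0.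
  lra.
have [N HN] := dyadic_levels_seq r0 t0 lam0 lt.
pose u (k : nat) := t / 2 ^+ k.
have u0 k : 0 < u k by rewrite divr_gt0// exprn_gt0.
have mt k : measurable_fun (@UHP R) (fun z => (trunc Theta F e (u k) z)%:E).
  by apply/measurable_EFinP; exact: measurable_trunc.
have tr0 k z : UHP z -> (0 <= (trunc Theta F e (u k) z)%:E)%E.
  by move=> Uz; rewrite lee_fin trunc_ge0.
have mU := @measurable_UHP R.
pose G k j := (2%:E * Vint a (hbox j) (fun z => (trunc Theta F e (u k) z)%:E))%E.
(* The packing inequality for the intervals whose norm exceeds the level [u k], charged to twice the
   integral of the truncated modular. *)
have pack k : ((\sum_(j <- s | u k < lam j) packing a * volume a j.2)%:E <=
    2%:E * Vint a (@UHP R) (fun z => (trunc Theta F e (u k) z)%:E))%E.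
  apply: (@le_trans _ _ (G k i)); last first.
    rewrite lee_wpmul2l ?lee_fin//; apply: subset_Vint => //.
    - exact: measurable_hbox.
    - exact: hbox_sub_UHP.
    - exact: tr0.
  apply: (@dyadic_packing R a n i (fun j => u k < lam j) (G k)) => //.
  - by move=> j; rewrite mule_ge0 ?lee_fin// Vint_ge0// => z /hbox_sub_UHP; exact: tr0.
  - move=> x l l0; rewrite /G -ge0_muleDr; last 2 first.
    + by rewrite Vint_ge0// => z /hbox_sub_UHP; exact: tr0.
    + by rewrite Vint_ge0// => z /hbox_sub_UHP; exact: tr0.
    by rewrite lee_wpmul2l ?lee_fin// Vint_hbox_halves// => z; exact: tr0.
  - by move=> j j0 h; exact: volume_le_trunc.
rewrite -(@lee_pmul2l _ (packing a)%:E)// ?lte_fin// muleA -!EFinM.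
have -> : packing a * (2 * K / packing a) = 2 * K by field; rewrite gt_eqF.
(* Each [lam j ^ r] is spread over the levels below [lam j]; exchanging the sums then groups the
   intervals by level, ready for [pack]. *)
apply: (@le_trans _ _ (\sum_(k < N) ((2 * u k) `^ r *
    \sum_(j <- s | u k < lam j) packing a * volume a j.2))%:E).
  rewrite lee_fin mulr_sumr big_seq.
  apply: (@le_trans _ _ (\sum_(j <- s | j \in s) \sum_(k < N | u k < lam j)
     (2 * u k) `^ r * (packing a * volume a j.2))).
    apply: ler_sum => j js; rewrite -mulr_suml.
    have -> : packing a * (volume a j.2 * orlicz_norm a Theta F j `^ r) = lam j `^ r * (packing a * volume a j.2) by rewrite /lam; ring.
    rewrite ler_wpM2r//; last exact: HN.
    by rewrite mulr_ge0 ?ltW// volume_gt0// (dyadic_gt0 i0 js).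
  rewrite -big_seq (exchange_big_dep xpredT)//=.
  by apply: ler_sum => k _; rewrite mulr_sumr.
apply: (@le_trans _ _ (\sum_(k < N) ((2 * u k) `^ r)%:E *
   (2%:E * Vint a (@UHP R) (fun z => (trunc Theta F e (u k) z)%:E)))%E).
  rewrite -sumEFin; apply: lee_sum => k _.
  by rewrite EFinM lee_wpmul2l ?lee_fin ?powR_ge0.
rewrite EFinM -muleA.
under eq_bigr do rewrite muleCA.
rewrite -ge0_sume_distrr; last first.
  by move=> k _; rewrite mule_ge0 ?lee_fin ?powR_ge0// Vint_ge0// => z; exact: tr0.
rewrite lee_wpmul2l ?lee_fin//.
under eq_bigr => k _.
  rewrite -VintZl//; last 2 first.
    by move=> z; exact: tr0.
    by rewrite lee_fin powR_ge0.
  over.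
rewrite -Vint_sum//; last 2 first.
- by move=> k; apply: emeasurable_funM => //; exact: measurable_cst.
- by move=> k z Uz; rewrite mule_ge0 ?lee_fin ?powR_ge0// -lee_fin tr0.
rewrite -VintZl//; last 3 first.
- by apply/measurable_EFinP; exact: (measurableT_comp (measurable_powR r)).
- by move=> z _; rewrite lee_fin powR_ge0.
- by rewrite lee_fin ltW.
apply: le_Vint => //.
- by apply: emeasurable_sum => k; apply: emeasurable_funM => //; exact: measurable_cst.
- apply: emeasurable_funM; first exact: measurable_cst.
  by apply/measurable_EFinP; exact: (measurableT_comp (measurable_powR r)).
- move=> z Uz; apply: sume_ge0 => k _.
  by rewrite mule_ge0 ?lee_fin ?powR_ge0// -lee_fin tr0.
- move=> z Uz; under eq_bigr do rewrite -EFinM.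
  rewrite sumEFin -EFinM lee_fin.
  by have := HK N (F z) t (F0 z Uz) t0.
Qed.

End carleson.

(** * Young and Hölder inequalities *)

Section holder.
Context {R : realType}.
Implicit Types (Phi Theta : R -> R).

Lemma young_ineq Phi Theta (s t : R) : complementary Phi Theta ->
  0 <= s -> 0 <= t -> t * s <= Phi t + Theta s.
Proof.
move=> cPT s0 t0; rewrite -lerBlDl -lee_fin (cPT s s0).
by apply: ereal_sup_ubound; exists t.
Qed.

(** The set whose infimum is [Luxemburg], named because estimates are proved for each admissible [l]
    before any infimum is taken. *)
Definition luxemburg_set (a : R) Phi (Q : set (R * R)) (u : R * R -> \bar R) :=
  [set l : R | 0 < l /\
     (((fine (Vmeas a Q))^-1)%:E *
        Vint a Q (fun z => PhiE Phi (`|u z| * (l^-1)%:E)) <= 1)%E].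

(** Stated for a [v] dominated pointwise through Young's inequality, so that one proof covers both
    [om * h] and [|f|], the latter with [u] infinite where [sig] vanishes. The 2 arises because both
    modulars are at most the volume. *)
Lemma orlicz_holder (a : R) Phi Theta (F : R * R -> R) (u v : R * R -> \bar R)
    (x1 x2 l : R) :
  -1 < a -> x1 < x2 -> Young Phi -> Young Theta ->
  measurable_fun (@UHP R) F -> (forall z, UHP z -> 0 <= F z) ->
  measurable_fun (@UHP R) v -> (forall z, UHP z -> 0 <= v z)%E ->
  (forall m : R, 0 < m ->
     measurable_fun (@UHP R) (fun z => PhiE Phi (`|u z| * (m^-1)%:E))%E) ->
  (forall (z : R * R) (m m' : R), UHP z -> 0 < m -> 0 < m' ->
     (v z <= (m * m')%:E * (PhiE Phi (`|u z| * (m^-1)%:E) + (Theta (F z / m'))%:E))%E) ->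
  (exists m, 0 < m /\
    (modular a Theta F (x1, (x2 - x1)%R) m <= (volume a (x2 - x1))%:E)%E) ->
  luxemburg_set a Phi (Qbox x1 x2) u l ->
  (Vint a (hbox (x1, x2 - x1)%R) v <=
   (2 * volume a (x2 - x1) * orlicz_norm a Theta F (x1, (x2 - x1)%R) * l)%:E)%E.
Proof.
move=> a1 x12 yP yT mF F0 mv v0 mPhi vle [m1 [m10 H1]] [l0 Hl].
set i := (x1, (x2 - x1)%R); set V := volume a (x2 - x1).
have V0 : 0 < V by rewrite volume_gt0// subr_gt0.
have hU := @hbox_sub_UHP R i.
have mh := @measurable_hbox R i.
have QU := @Qbox_sub_UHP R x1 x2.
have hQ : hbox i `<=` Qbox x1 x2.
  move=> z [/= /andP[h1 h2] h3]; split => //.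
  by rewrite h1 /=; lra.
have PhiE0 z : (0 <= PhiE Phi (`|u z| * (l^-1)%:E))%E.
  have : (0 <= `|u z| * (l^-1)%:E)%E by rewrite mule_ge0// lee_fin invr_ge0 ltW.
  by case: (_ * _)%E => [r| |]//= r0; rewrite lee_fin (Young_ge0 yP).
have mU := @measurable_UHP R.
have PhiV : (Vint a (hbox i) (fun z => PhiE Phi (`|u z| * (l^-1)%:E)) <= V%:E)%E.
  apply: (@le_trans _ _ (Vint a (Qbox x1 x2) (fun z => PhiE Phi (`|u z| * (l^-1)%:E)))).
    apply: subset_Vint => //; first exact: measurable_Qbox.
    by apply: measurable_funS (mPhi l l0).
  move: Hl; rewrite Vmeas_Qbox//= -/(volume a (x2 - x1)) -/V => Hl.
  by rewrite -(@lee_pmul2l _ (V^-1)%:E)// ?lte_fin ?invr_gt0// -EFinM mulVf ?gt_eqF.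
have key m : 0 < m -> orlicz_norm a Theta F i < m ->
    (Vint a (hbox i) v <= (2 * V * m * l)%:E)%E.
  move=> m0 nm; have Hm := gt_orlicz_norm yT mF F0 m10 H1 nm.
  have m1' := measurable_funS mU hU (mPhi l l0).
  have m2' := @measurable_modular R Theta F yT mF F0 m i m0.
  have T0 z : hbox i z -> (0 <= (Theta (F z / m))%:E)%E.
    by move=> /hU/F0 Fz; rewrite lee_fin (Young_ge0 yT)// divr_ge0// ltW.
  apply: (@le_trans _ _ (Vint a (hbox i) (fun z => (l * m)%:E *
      (PhiE Phi (`|u z| * (l^-1)%:E) + (Theta (F z / m))%:E))%E)).
    apply: le_Vint => //; first exact: measurable_funS mv.
    - apply: emeasurable_funM; first exact: measurable_cst.
      exact: emeasurable_funD.
    - by move=> z /hU; exact: v0.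
    - by move=> z /hU Uz; exact: vle.
  rewrite VintZl//; last 3 first.
  - exact: emeasurable_funD.
  - by move=> z hz; rewrite adde_ge0// T0.
  - by rewrite lee_fin mulr_ge0 ?ltW.
  rewrite VintD//.
  have -> : 2 * V * m * l = l * m * (V + V) by ring.
  by rewrite [leRHS]EFinM lee_wpmul2l ?lee_fin ?mulr_ge0 ?(ltW l0) ?(ltW m0)// EFinD leeD.
set n := orlicz_norm a Theta F i.
have n0 : 0 <= n by exact: orlicz_norm_ge0.
(* The infimum [n] may be 0 or not attained, so the estimate is used at [n + d], with [d] tuned to
   make the excess equal to [e]. *)
apply/lee_addgt0Pr => e e0.
pose d := e / (2 * V * l).
have d0 : 0 < d by rewrite divr_gt0// mulr_gt0// mulr_gt0.
have nd0 : 0 < n + d by rewrite ltr_wpDl.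
have nd : n < n + d by rewrite ltrDl.
apply: le_trans (key _ nd0 nd) _.
rewrite -EFinD lee_fin.
have -> : 2 * V * (n + d) * l = 2 * V * n * l + e by rewrite /d; field; rewrite !gt_eqF.
by [].
Qed.

(* If one infimum vanishes, so does the corresponding factor [X] or [Y]; the other
   infimum may then be infinite, as [0 * +oo = 0]. *)
Lemma inf_product_le (SA SB : set R) (X Y : \bar R) (c1 c2 w C : R) :
  (0 <= X)%E -> (0 <= Y)%E -> 0 <= c1 -> 0 <= c2 -> 0 < w -> 0 < C ->
  (forall l, SA l -> 0 < l) -> (forall l, SB l -> 0 < l) ->
  (forall l, SA l -> (X <= (c1 * l)%:E)%E) ->
  (forall l, SB l -> (Y <= (c2 * l)%:E)%E) ->
  (w%:E * ereal_inf [set l%:E | l in SA] * ereal_inf [set l%:E | l in SB] <= C%:E)%E ->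
  (X * Y <= (4 * c1 * c2 * C / w)%:E)%E.
Proof.
move=> X0 Y0 c10 c20 w0 C0 SA0 SB0 XA YB.
have inf0 (S : set R) (Z : \bar R) (c : R) : 0 <= c -> (0 <= Z)%E ->
    (forall l, S l -> (Z <= (c * l)%:E)%E) ->
    ereal_inf [set l%:E | l in S] = 0%E -> Z = 0%E.
  move=> c0 Z0 ZS S0; apply/eqP; rewrite eq_le Z0 andbT.
  apply/lee_addgt0Pr => e e0; rewrite add0e.
  have d0 : 0 < e / (c + 1) by rewrite divr_gt0//; lra.
  have [|_ [l Sl <-] ld] := @ereal_inf_lt R [set l%:E | l in S] (e / (c + 1))%:E.
    by rewrite S0 lte_fin.
  apply: le_trans (ZS _ Sl) _; rewrite lee_fin.
  rewrite lte_fin in ld.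
  apply: (@le_trans _ _ (c * (e / (c + 1)))); first by rewrite ler_wpM2l// ltW.
  by rewrite mulrA ler_pdivrMr; nra.
have R0 : (0 <= (4 * c1 * c2 * C / w)%:E)%E.
  by rewrite lee_fin !mulr_ge0 ?invr_ge0 ?(ltW C0) ?(ltW w0).
have ge0 (S : set R) : (forall l, S l -> 0 < l) -> (0 <= ereal_inf [set l%:E | l in S])%E.
  by move=> S0; apply: le_ereal_inf_tmp => _ [l /S0 l0 <-]; rewrite lee_fin ltW.
(* A positive infimum [r] has an element of the set below [2 * r]; using this for both sets gives
   the 4. *)
have gtA (S : set R) (Z : \bar R) (c r : R) : 0 <= c -> 0 < r ->
    (forall l, S l -> (Z <= (c * l)%:E)%E) ->
    ereal_inf [set l%:E | l in S] = r%:E -> (Z <= (c * (2 * r))%:E)%E.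
  move=> c0 r0 ZS Sr.
  have [|_ [l Sl <-] ld] := @ereal_inf_lt R [set l%:E | l in S] (2 * r)%:E.
    by rewrite Sr lte_fin; lra.
  apply: le_trans (ZS _ Sl) _; rewrite lee_fin ler_wpM2l//.
  by move: ld; rewrite lte_fin => /ltW.
move: (ge0 SA SA0) (ge0 SB SB0).
have := inf0 SA X c1 c10 X0 XA; have := inf0 SB Y c2 c20 Y0 YB.
have := gtA SA X c1 ^~ c10; have := gtA SB Y c2 ^~ c20.
case: (ereal_inf [set l%:E | l in SA]) => [r| |]//;
  case: (ereal_inf [set l%:E | l in SB]) => [r'| |]//.
- move=> gB gA iB iA; rewrite !lee_fin le_eqVlt => /predU1P[r0|r0].
    by rewrite iA ?mul0e// -r0.
  rewrite le_eqVlt => /predU1P[r'0|r'0].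
    by rewrite iB ?mule0// -r'0.
  move=> wC; have {}wC : w * r * r' <= C by exact: wC.
  have {}gA := gA r r0 XA erefl; have {}gB := gB r' r'0 YB erefl.
  apply: le_trans (lee_pmul X0 Y0 gA gB) _.
  rewrite -EFinM lee_fin ler_pdivlMr//.
  have -> : c1 * (2 * r) * (c2 * (2 * r')) * w = 4 * c1 * c2 * (w * r * r') by ring.
  by rewrite ler_wpM2l// !mulr_ge0.
(* With one infimum infinite and the other positive, the product in the hypothesis would be
   infinite. *)
- move=> _ _ _ iA; rewrite lee_fin le_eqVlt => /predU1P[r0|r0] _.
    by rewrite iA ?mul0e// -r0.
  by rewrite -EFinM gt0_muley ?lte_fin ?mulr_gt0// leye_eq.
- move=> _ _ iB _ _; rewrite lee_fin le_eqVlt => /predU1P[r0|r0].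
    by rewrite iB ?mule0// -r0.
  by rewrite gt0_muley ?lte_fin// gt0_mulye ?lte_fin// leye_eq.
- by move=> _ _ _ _ _ _; rewrite (@gt0_muley _ w%:E) ?lte_fin// mulyy leye_eq.
Qed.

(** Each [x j / S] is at most 1, so its [q]-th power is at most its [p]-th power; this is how
    [p <= q] is exploited. Young's inequality with the conjugate pair [q], [q'] then finishes. *)
Lemma sum_mul_le (I : eqType) (s : seq I) (x y : I -> R) (p q q' S T : R) :
  0 < p -> p <= q -> 0 < q' -> q^-1 + q'^-1 = 1 -> 0 < S -> 0 < T ->
  (forall j, j \in s -> 0 <= x j) -> (forall j, j \in s -> 0 <= y j) ->
  \sum_(j <- s) x j `^ p <= S `^ p -> \sum_(j <- s) y j `^ q' <= T `^ q' ->
  \sum_(j <- s) x j * y j <= S * T.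
Proof.
move=> p0 pq q'0 qq' S0 T0 x0 y0 Hx Hy; have q0 : 0 < q by lra.
have xS j : j \in s -> x j <= S.
  move=> js; rewrite leNgt; apply/negP => Sx.
  have : S `^ p < x j `^ p by rewrite gt0_ltr_powR ?nnegrE ?(ltW S0) ?x0.
  apply/negP; rewrite -leNgt; apply: le_trans Hx.
  by rewrite (big_rem j)//= lerDl sumr_ge0// => k _; exact: powR_ge0.
apply: (@le_trans _ _ (\sum_(j <- s) S * T * (x j `^ p / S `^ p / q + y j `^ q' / T `^ q' / q'))).
  rewrite big_seq [leRHS]big_seq; apply: ler_sum => j js.
  have xj := x0 j js; have yj := y0 j js.
  have -> : x j * y j = S * T * (x j / S * (y j / T)) by field; rewrite !gt_eqF.
  rewrite ler_wpM2l ?mulr_ge0 ?(ltW S0) ?(ltW T0)//.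
  apply: le_trans (conjugate_powR _ _ q0 q'0 qq') _; rewrite ?divr_ge0 ?(ltW S0) ?(ltW T0)//.
  have dE (u v r : R) : 0 <= u -> 0 < v -> (u / v) `^ r = u `^ r / v `^ r.
    move=> u0 v0; rewrite powRM ?invr_ge0 ?(ltW v0)//; congr (_ * _).
    by rewrite -(powR_inv1 (ltW v0)) -powRrM mulN1r powRN.
  rewrite (dE _ _ q')// lerD2r ler_pM2r ?invr_gt0// -(dE _ _ p)//.
  have [->|xn0] := eqVneq (x j) 0; first by rewrite mul0r !powR0 ?gt_eqF.
  have xp : 0 < x j by rewrite lt0r xn0 xj.
  apply: ger_powR => //; rewrite divr_gt0//=.
  by rewrite ler_pdivrMr// mul1r xS.
rewrite -mulr_sumr -[leRHS]mulr1 ler_wpM2l ?mulr_ge0 ?(ltW S0) ?(ltW T0)//.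
rewrite big_split/= -!mulr_suml -qq' lerD//.
  by rewrite ler_piMl ?invr_ge0 ?(ltW q0)// ler_pdivrMr ?powR_gt0// mul1r.
by rewrite ler_piMl ?invr_ge0 ?(ltW q'0)// ler_pdivrMr ?powR_gt0// mul1r.
Qed.

End holder.

(** * Two shifted dyadic grids and the kernel *)

Section geometry.
Context {R : realType}.
Implicit Types (a g : R) (z w : R * R).

(* [L / 3] is at distance at least [l / 3] from every multiple of [l = L / 2 ^+ k],
   because 3 does not divide [2 ^ k]; hence the endpoints of the two grids stay
   [l / 3] apart at every scale. *)
Lemma third_shift (u L x y : R) (k : nat) : 0 < L ->
  u + L / 3 <= x -> x <= y -> y < u + L -> y - x < L / 2 ^+ k / 3 ->
  exists m, (m < 2 ^ k)%N /\
   ((u + m%:R * (L / 2 ^+ k) <= x /\ y < u + m%:R * (L / 2 ^+ k) + L / 2 ^+ k) \/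
    (u + L / 3 + m%:R * (L / 2 ^+ k) <= x /\
     y < u + L / 3 + m%:R * (L / 2 ^+ k) + L / 2 ^+ k)).
Proof.
move=> L0 ux xy yu yx; set l := L / 2 ^+ k.
have l0 : 0 < l by rewrite divr_gt0// exprn_gt0.
have LE : L = (2 ^ k)%:R * l by rewrite /l natrX mulrC divfK// expf_neq0// pnatr_eq0.
have yx' : y - x < l / 3 by [].
clearbody l; clear yx.
have q0 : 0 <= (x - u) / l by rewrite divr_ge0//; lra.
pose m := Num.truncn ((x - u) / l).
have /andP[m1 m2] : m%:R <= (x - u) / l < m.+1%:R by exact: truncn_itv.
have {}m1 : m%:R * l <= x - u by rewrite -ler_pdivlMr.
have {}m2 : x - u < m%:R * l + l.
  have -> : m%:R * l + l = m.+1%:R * l by rewrite -natr1 mulrDl mul1r.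
  by rewrite -ltr_pdivrMr.
clearbody m.
have mk : (m < 2 ^ k)%N.
  rewrite -(@ltr_nat R) -(ltr_pM2r l0) -LE.
  by apply: le_lt_trans m1 _; lra.
have [h|h] := ltP y (u + m%:R * l + l); first by exists m; split => //; left; split; lra.
(* Here [y] has crossed the right end of cell [m], so [x] is within [l / 3] of it. As
   [L / 3 = c * l + rho * l / 3], the cell of the shifted grid with index [m - c] starts
   [rho * l / 3] after cell [m] and contains both points. *)
have [c [rho [kE rho1 rho2]]] : exists c rho, [/\ (2 ^ k = 3 * c + rho)%N, (1 <= rho)%N & (rho <= 2)%N].
  exists (2 ^ k %/ 3)%N, (2 ^ k %% 3)%N; split; [lia| |by have := ltn_pmod (2 ^ k) (isT : 0 < 3)%N; lia].
  rewrite lt0n; apply/negP => d3.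
  have : (3 %| 2 ^ k)%N by [].
  by rewrite Euclid_dvdX.
have rE : (2 ^ k)%:R = 3 * c%:R + rho%:R :> R by rewrite kE natrD natrM.
have r1 : 1 <= rho%:R :> R by rewrite ler1n.
have r2 : rho%:R <= 2 :> R by rewrite ler_nat.
rewrite {}rE in LE.
(* Because [c * l <= L / 3 <= x - u < (m + 1) * l]. *)
have cm : (c <= m)%N.
  rewrite -ltnS -(@ltr_nat R) -natr1 -(ltr_pM2r l0).
  nra.
exists (m - c)%N; split; first by lia.
by right; rewrite natrB// LE; split; nra.
Qed.

Definition core (N : nat) : set (R * R) :=
  [set z | - N%:R <= z.1 <= N%:R /\ N%:R^-1 <= z.2 <= N%:R].

(** On [core N] the distance [refl_dist] is at most [3 * N], so a third of the length [16 * N]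
    exceeds it, and [[-N, N]] lies in the part common to the base interval and its translate. The
    depth is explained by [kD] in [common_box]. *)
Definition grids (N : nat) : seq (R * R) :=
  dyadic (3 * N ^ 2) (- (8 * N%:R), 16 * N%:R) ++
  dyadic (3 * N ^ 2) (- (8 * N%:R) + 16 * N%:R / 3, 16 * N%:R).

Definition refl_dist z w : R := Num.sqrt ((z.1 - w.1) ^+ 2 + (z.2 + w.2) ^+ 2).

Lemma common_box (N : nat) z w : (0 < N)%N -> core N z -> core N w ->
  exists j, [/\ j \in grids N, hbox j z, hbox j w & j.2 <= 6 * refl_dist z w].
Proof.
wlog xy : z w / z.1 <= w.1.
  move=> H N0 zN wN; have [|/ltW] := leP z.1 w.1; first by move=> /H; exact.
  move=> /H /(_ N0 wN zN) [j [jN jw jz jd]]; exists j; split => //.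
  by rewrite /refl_dist -(opprB w.1) sqrrN [z.2 + _]addrC.
move=> N0; case: z xy => [x y]; case: w => [x' y'] /= xx [/= /andP[hx1 hx2] /andP[hy1 hy2]].
move=> [/= /andP[hx1' hx2'] /andP[hy1' hy2']].
have n1 : 1 <= N%:R :> R by rewrite ler1n.
have nV : N%:R * N%:R^-1 = 1 :> R by rewrite mulfV// gt_eqF//; lra.
have nV0 : 0 < N%:R^-1 :> R by rewrite invr_gt0; lra.
set d := refl_dist _ _.
have d0 : 0 <= d by exact: sqrtr_ge0.
have dE : d ^+ 2 = (x - x') ^+ 2 + (y + y') ^+ 2.
  by rewrite sqr_sqrtr// addr_ge0// sqr_ge0.
clearbody d.
have sq_le (u v : R) : 0 <= v -> u ^+ 2 <= v ^+ 2 -> u <= v.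
  by move=> v0 h; rewrite leNgt; apply/negP => vu; nra.
have dx : x' - x <= d by apply: sq_le => //; rewrite dE; nra.
have dy : y + y' <= d by apply: sq_le => //; rewrite dE; nra.
have dN : d <= 3 * N%:R by apply: sq_le; [lra|rewrite dE; nra].
have d1 : 0 < d by lra.
pose L : R := 16 * N%:R.
have L0 : 0 < L by rewrite /L; lra.
(* The least such [k] gives [3 * d < L / 2 ^+ k <= 6 * d]: the lower bound makes the box tall enough
   and [x' - x] smaller than a third of its side, the upper bound is the constant 6. *)
have exk : exists k, L / 2 ^+ k.+1 <= 3 * d.
  exists (Num.bound (L / (3 * d))); rewrite ler_pdivrMr ?exprn_gt0// mulrC -ler_pdivrMr ?mulr_gt0//.
  apply: (@le_trans _ _ (Num.bound (L / (3 * d)))%:R).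
    by apply/ltW; rewrite archi_boundP// divr_ge0 ?mulr_ge0// ltW.
  by rewrite -natrX ler_nat ltnW// (leq_trans _ (ltn_expl _ _))// ltnS.
case: (ex_minnP exk) => k kd kmin.
have k3 : 3 * d < L / 2 ^+ k.
  case: k kd kmin => [|k] kd kmin; first by rewrite expr0 divr1 /L; lra.
  by rewrite ltNge; apply/negP => /kmin; rewrite ltnn.
have k6 : L / 2 ^+ k <= 6 * d.
  by move: kd; rewrite exprS invfM mulrCA => h; lra.
(* Since [d >= 2 / N], the bound [3 * d < L / 2 ^+ k] forces [2 ^ k < 8 / 3 * N ^ 2], and
   [k < 2 ^ k]. *)
have kD : (k < 3 * N ^ 2)%N.
  apply: leq_trans (ltn_expl k (isT : 1 < 2)%N) _.
  rewrite -(@ler_nat R) natrX natrM natrX.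
  move: k3; rewrite ltr_pdivlMr ?exprn_gt0// /L => k3.
  have p0 : 0 < 2 ^+ k :> R by rewrite exprn_gt0.
  move: (2 ^+ k) p0 k3 => e e0 k3.
  have : 6 * N%:R^-1 * e < 16 * N%:R :> R.
    apply: le_lt_trans k3; rewrite ler_wpM2r// ?(ltW e0)//; lra.
  move=> h; have : N%:R * (6 * N%:R^-1 * e) < N%:R * (16 * N%:R) by rewrite ltr_pM2l//; lra.
  have -> : N%:R * (6 * N%:R^-1 * e) = 6 * e by rewrite !mulrA [_ * 6]mulrC -(mulrA 6) nV mulr1.
  by nra.
have [||||m [mk]] := @third_shift (- (8 * N%:R)) L x x' k L0; rewrite /L; try lra.
  by move: k3; rewrite /L; lra.
move=> [[h1 h2]|[h1 h2]].
- exists (- (8 * N%:R) + m%:R * (L / 2 ^+ k), L / 2 ^+ k); split => //=.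
  + by rewrite mem_cat (@mem_dyadic R _ k m (- (8 * N%:R), 16 * N%:R) kD mk).
  + by split => /=; rewrite /L; [lra|move: k3; rewrite /L; lra].
  + by split => /=; rewrite /L; [lra|move: k3; rewrite /L; lra].
- exists (- (8 * N%:R) + 16 * N%:R / 3 + m%:R * (L / 2 ^+ k), L / 2 ^+ k); split => //=.
  + by rewrite mem_cat (@mem_dyadic R _ k m (- (8 * N%:R) + 16 * N%:R / 3, 16 * N%:R) kD mk) orbT.
  + by split => /=; rewrite /L; [lra|move: k3; rewrite /L; lra].
  + by split => /=; rewrite /L; [lra|move: k3; rewrite /L; lra].
Qed.

Lemma kern_le_grids (N : nat) a g z w : (0 < N)%N -> g < 2 + a ->
  core N z -> core N w ->
  kern a g z w <= 6 `^ (2 + a - g) *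
    \sum_(j <- grids N) (j.2 `^ (2 + a - g))^-1 * \1_(hbox j) z * \1_(hbox j) w.
Proof.
move=> N0 ga zN wN; have [j [jN jz jw jd]] := common_box N0 zN wN.
have s0 : 0 < 2 + a - g by lra.
have j0 : 0 < j.2 by case: jz => _ /andP[]; exact: lt_trans.
rewrite (big_rem j)//= !indicE !mem_set// !mulr1.
have d0 : 0 < refl_dist z w by lra.
apply: (@le_trans _ _ (6 `^ (2 + a - g) * (j.2 `^ (2 + a - g))^-1)).
  rewrite /kern -/(refl_dist z w) -ler_pdivrMl ?powR_gt0//.
  rewrite -invfM lef_pV2 ?posrE ?mulr_gt0 ?powR_gt0// -powRM ?(ltW d0)//.
  by rewrite ge0_ler_powR ?nnegrE ?mulr_ge0 ?(ltW j0) ?(ltW d0) ?(ltW s0).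
rewrite ler_wpM2l ?powR_ge0// lerDl sumr_ge0// => k _.
by rewrite !mulr_ge0 ?invr_ge0 ?powR_ge0.
Qed.

End geometry.

(** * Compact rectangles and the dyadic bilinear form *)

Section bilinear.
Context {R : realType}.

Lemma core_prod (N : nat) :
  core N = `[- N%:R, N%:R] `*` `[N%:R^-1, N%:R] :> set (R * R).
Proof. by apply/seteqP; split => z /=; rewrite /core /= !in_itv/=. Qed.

Lemma measurable_core (N : nat) : measurable (@core R N).
Proof. by rewrite core_prod; apply: measurableX. Qed.

(** The index is shifted because [core 0] is the origin, [0^-1] being 0. *)
Lemma core_sub_UHP (N : nat) : @core R N.+1 `<=` @UHP R.
Proof. by move=> z [_ /andP[h _]]; apply: lt_le_trans h; rewrite invr_gt0. Qed.

Lemma core_mono (m n : nat) : (0 < m)%N -> (m <= n)%N -> @core R m `<=` @core R n.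
Proof.
move=> m0 mn z [/andP[h1 h2] /andP[h3 h4]].
have mn' : m%:R <= n%:R :> R by rewrite ler_nat.
have mV : n%:R^-1 <= m%:R^-1 :> R by rewrite lef_pV2 ?posrE ?ltr0n// (leq_trans m0).
by split; apply/andP; split; lra.
Qed.

Lemma core_exhaust (z : R * R) : UHP z -> exists n, forall m, (n <= m)%N -> core m.+1 z.
Proof.
rewrite /UHP/= => z0.
exists (Num.bound (Num.max `|z.1| (Num.max z.2 z.2^-1))) => m nm.
have : Num.max `|z.1| (Num.max z.2 z.2^-1) < m.+1%:R.
  apply: lt_le_trans (archi_boundP _) _; first by rewrite le_max normr_ge0.
  by rewrite ler_nat ltnW.
rewrite !gt_max ltr_norml => /and3P[/andP[h1 h2] h3 h4].
split; apply/andP; split; try exact: ltW.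
by rewrite -[leRHS]invrK lef_pV2 ?posrE ?invr_gt0// ltW.
Qed.

Lemma bigcup_core : \bigcup_n @core R n.+1 = @UHP R.
Proof.
apply/seteqP; split => z; first by move=> [n _ /core_sub_UHP].
by move=> /core_exhaust[n H]; exists n => //; exact: H.
Qed.

(** Local integrability gives measurability on each compact rectangle, and countably many of them
    cover the half-plane. *)
Lemma weight_measurable (w : R * R -> R) : weight w -> measurable_fun (@UHP R) w.
Proof.
move=> [_ wK]; rewrite -bigcup_core; apply/measurable_fun_bigcup.
  by move=> n; exact: measurable_core.
move=> n; apply/measurable_EFinP; apply: measurable_int (wK _ _ _).
  by rewrite core_prod; apply: compact_setX; exact: segment_compact.
exact: core_sub_UHP.
Qed.

Lemma measurable_normr_fun (D : set (R * R)) (f : R * R -> R) :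
  measurable_fun D f -> measurable_fun D (fun z => `|f z|).
Proof. by move=> mf; exact: (measurableT_comp (normr_measurable (D := setT))). Qed.

Lemma measurable_PhiE_fin Phi (u : R * R -> R) (m : R) : Young Phi ->
  measurable_fun (@UHP R) u -> 0 < m ->
  measurable_fun (@UHP R) (fun z => PhiE Phi (`|(u z)%:E| * (m^-1)%:E))%E.
Proof.
move=> yP mu m0; apply/measurable_EFinP.
apply: Young_measurable => //; first exact: measurable_UHP.
  by apply: measurable_funM; [exact: measurable_normr_fun|exact: measurable_cst].
by move=> z _; rewrite mulr_ge0// invr_ge0 ltW.
Qed.

Lemma measurable_PhiE_sigma_inv Phi (sig : R * R -> R) (m : R) : Young Phi ->
  weight sig -> 0 < m ->
  measurable_fun (@UHP R) (fun z => PhiE Phi (`|sigma_inv sig z| * (m^-1)%:E))%E.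
Proof.
move=> yP wsig m0; have ms := weight_measurable wsig.
have -> : (fun z => PhiE Phi (`|sigma_inv sig z| * (m^-1)%:E))%E =
    (fun z => if sig z == 0 then +oo%E else PhiE Phi (`|((sig z)^-1)%:E| * (m^-1)%:E)%E).
  apply/funext => z; rewrite /sigma_inv; case: ifP => // _.
  by rewrite /= gt0_mulye// lte_fin invr_gt0.
apply: measurable_fun_if; first exact: measurable_UHP.
- by apply: measurable_fun_eqr => //; exact: measurable_cst.
- exact: measurable_cst.
- apply: (measurable_funS (measurable_UHP)); first exact: subIsetl.
  apply: measurable_PhiE_fin => //.
  apply: measurable_inv_ge0 => //; first exact: measurable_UHP.
  by case: wsig.
Qed.

Section tree_bound.
Variables (a g p q : R) (Phi Psi Phic Psic : R -> R) (om sig : R * R -> R) (C : R).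
Hypotheses (a1 : -1 < a) (p1 : 1 < p) (pq : p <= q).
Hypotheses (yPhi : Young Phi) (yPsi : Young Psi).
Hypotheses (cPhi : complementary Phi Phic) (cPsi : complementary Psi Psic).
Hypotheses (bPhi : B_class p Phic) (bPsi : B_class (q / (q - 1)) Psic).
Hypotheses (wom : weight om) (wsig : weight sig) (C0 : 0 < C).
Hypothesis bump : forall x1 x2 : R, x1 < x2 ->
  ((Vmeas a (Qbox x1 x2)) `^ (g / (2 + a) + q^-1 - p^-1) *
    Luxemburg a Psi (Qbox x1 x2) (fun z => (om z)%:E) *
    Luxemburg a Phi (Qbox x1 x2) (sigma_inv sig) <= C%:E)%E.

Let q' := q / (q - 1).

Let q0 : 0 < q. Proof. exact: lt_le_trans (lt_trans ltr01 p1) pq. Qed.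

Let qm1 : 0 < q - 1. Proof. by rewrite subr_gt0 (lt_le_trans p1). Qed.

Let q'1 : 1 < q'. Proof. by rewrite /q' ltr_pdivlMr// mul1r gtrBl. Qed.

Let qq' : q^-1 + q'^-1 = 1.
Proof.
by rewrite /q' invf_div -[X in X + _]mul1r -mulrDl addrC subrK mulfV// gt_eqF.
Qed.

(** The constant 16 is the 4 of [inf_product_le] times the 2 of each [orlicz_holder]; the power of
    [a + 1] converts [l] into the volume. *)
Lemma box_bound (f h : R * R -> R) (j : R * R) : 0 < j.2 ->
  measurable_fun (@UHP R) f -> measurable_fun (@UHP R) h ->
  (forall z, UHP z -> 0 <= h z) ->
  (Vint a (@UHP R) (fun z => (`|f z * sig z| `^ p)%:E) < +oo)%E ->
  (Vint a (@UHP R) (fun z => (h z `^ q')%:E) < +oo)%E ->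
  (((j.2 `^ (2 + a - g))^-1)%:E *
   (Vint a (hbox j) (fun z => (om z * h z)%:E) * Vint a (hbox j) (fun z => `|f z|%:E))
   <= (16 * C * (a + 1) `^ (g / (2 + a) - 1) *
       ((volume a j.2 `^ p^-1 * orlicz_norm a Phic (fun z => `|f z * sig z|%R) j) *
        (volume a j.2 `^ q'^-1 * orlicz_norm a Psic h j)))%:E)%E.
Proof.
case: j => x l /= l0 mf mh h0 fsfin hfin.
have mom := weight_measurable wom; have msig := weight_measurable wsig.
have [om0 _] := wom; have [sig0 _] := wsig.
have [yPhic _ _] := bPhi; have [yPsic _ _] := bPsi.
pose F z := `|f z * sig z|.
have mF : measurable_fun (@UHP R) F by apply: measurable_normr_fun; exact: measurable_funM.
have F0 z : UHP z -> 0 <= F z by rewrite /F.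
have x12 : x < x + l by rewrite ltrDl.
have lE : x + l - x = l by rewrite addrC addKr.
have V0 := volume_gt0 a1 l0.
set V := volume a l in V0 *.
set nF := orlicz_norm a Phic _ _; set nH := orlicz_norm a Psic _ _.
have nF0 : 0 <= nF by exact: orlicz_norm_ge0.
have nH0 : 0 <= nH by exact: orlicz_norm_ge0.
set X := Vint a _ (fun z => (om z * h z)%:E); set Y := Vint a _ (fun z => `|f z|%:E).
have hU := @hbox_sub_UHP R (x, l).
have X0 : (0 <= X)%E.
  by apply: Vint_ge0 => z /hU Uz; rewrite lee_fin mulr_ge0 ?om0 ?h0.
have Y0 : (0 <= Y)%E by apply: Vint_ge0 => z _; rewrite lee_fin.
have XA m : luxemburg_set a Psi (Qbox x (x + l)) (fun z => (om z)%:E) m ->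
    (X <= (2 * V * nH * m)%:E)%E.
  have := @orlicz_holder R a Psi Psic h (fun z => (om z)%:E)
    (fun z => (om z * h z)%:E) x (x + l) m a1 x12 yPsi yPsic mh h0.
  rewrite lE; apply.
  - by apply/measurable_EFinP; exact: measurable_funM.
  - by move=> z Uz; rewrite lee_fin mulr_ge0 ?om0 ?h0.
  - by move=> m' m'0; exact: measurable_PhiE_fin.
  - move=> z m1 m2 Uz m10 m20 /=; rewrite -EFinD -EFinM lee_fin ger0_norm ?om0//.
    have := young_ineq cPsi (_ : 0 <= h z / m2) (_ : 0 <= om z / m1).
    rewrite !divr_ge0 ?om0 ?h0 ?(ltW m10) ?(ltW m20)// => /(_ isT isT) H.
    apply: le_trans (ler_wpM2l _ H); last by rewrite mulr_ge0// ltW.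
    by rewrite (_ : m1 * m2 * _ = om z * h z)//; field; rewrite !gt_eqF.
  - exact: (orlicz_norm_fin (i := (x, l)) a1 yPsic mh h0 l0 q'1 bPsi hfin).
have YB m : luxemburg_set a Phi (Qbox x (x + l)) (sigma_inv sig) m ->
    (Y <= (2 * V * nF * m)%:E)%E.
  have := @orlicz_holder R a Phi Phic F (sigma_inv sig)
    (fun z => `|f z|%:E) x (x + l) m a1 x12 yPhi yPhic mF F0.
  rewrite lE; apply.
  - by apply/measurable_EFinP; exact: measurable_normr_fun.
  - by move=> z Uz; rewrite lee_fin.
  - by move=> m' m'0; exact: measurable_PhiE_sigma_inv.
  - move=> z m1 m2 Uz m10 m20 /=; rewrite /sigma_inv.
    (* Where [sig] vanishes, [f * sig] carries no information on [f], but the dominating term is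
       [+oo]. *)
    have [s0|sn0] := eqVneq (sig z) 0.
      rewrite /= gt0_mulye ?lte_fin ?invr_gt0//= addye//.
      by rewrite gt0_muley ?leey// lte_fin mulr_gt0.
    have s0 : 0 < sig z by rewrite lt0r sn0 sig0.
    rewrite /= -EFinD -EFinM lee_fin [`|_^-1|]ger0_norm ?invr_ge0 ?(ltW s0)//.
    have := young_ineq cPhi (_ : 0 <= F z / m2) (_ : 0 <= (sig z)^-1 / m1).
    rewrite !divr_ge0 ?invr_ge0 ?F0 ?(ltW m10) ?(ltW m20) ?(ltW s0)// => /(_ isT isT) H.
    apply: le_trans (ler_wpM2l _ H); last by rewrite mulr_ge0// ltW.
    rewrite (_ : m1 * m2 * _ = `|f z|)//.
    by rewrite /F normrM (gtr0_norm s0); field; rewrite !gt_eqF.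
  - exact: (orlicz_norm_fin (i := (x, l)) a1 yPhic mF F0 l0 p1 bPhi fsfin).
have := bump x12; rewrite Vmeas_Qbox// lE -/(volume a l) -/V => bmp.
set e := g / (2 + a) + q^-1 - p^-1 in bmp.
have XY : (X * Y <= (4 * (2 * V * nH) * (2 * V * nF) * C / (V `^ e))%:E)%E.
  apply: (inf_product_le X0 Y0 _ _ (powR_gt0 e V0) C0 _ _ XA YB bmp).
  - by rewrite mulr_ge0// mulr_ge0// ltW.
  - by rewrite mulr_ge0// mulr_ge0// ltW.
  - by move=> m [].
  - by move=> m [].
apply: le_trans (lee_wpmul2l _ XY) _; first by rewrite lee_fin invr_ge0 powR_ge0.
rewrite -EFinM lee_fin.
have s2 : 0 < 2 + a by move: (a) a1 => a' a1'; lra.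
have b0 : 0 < a + 1 by move: (a) a1 => a' a1'; lra.
have lV : l `^ (2 + a - g) = ((a + 1) * V) `^ ((2 + a - g) / (2 + a)).
  rewrite /V /volume mulrA mulfV ?gt_eqF// mul1r -powRrM; congr (_ `^ _).
  by field; rewrite gt_eqF.
have -> : (l `^ (2 + a - g))^-1 = (a + 1) `^ (g / (2 + a) - 1) * V `^ (g / (2 + a) - 1).
  rewrite lV -powRN -powRM ?(ltW b0) ?(ltW V0)//; congr (_ `^ _).
  by field; rewrite gt_eqF.
have VV : V `^ (g / (2 + a) - 1) * (V * V) / V `^ e = V `^ p^-1 * V `^ q'^-1.
  rewrite -{2 3}(powRr1 (ltW V0)) -powRN -!powRD; try by rewrite (gt_eqF V0) implybT.
  congr (_ `^ _); rewrite /e; move: qq'.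
  by move: (g / _) (q^-1) (p^-1) (q'^-1) => A B D E hh; lra.
rewrite [leLHS](_ : _ = 16 * C * (a + 1) `^ (g / (2 + a) - 1) * (nF * nH) *
  (V `^ (g / (2 + a) - 1) * (V * V) / V `^ e)); last by ring.
by rewrite VV [leRHS](_ : _ = 16 * C * (a + 1) `^ (g / (2 + a) - 1) * (nF * nH) *
  (V `^ p^-1 * V `^ q'^-1))//; ring.
Qed.

(** [S] and [T] are arbitrary positive upper bounds of the two norms, which lets [sum_mul_le] divide
    by them even if a norm is 0. *)
Lemma tree_bound : exists M : R, 0 < M /\
  forall (f h : R * R -> R) (S T : R) n i, 0 < i.2 -> 0 < S -> 0 < T ->
  measurable_fun (@UHP R) f -> measurable_fun (@UHP R) h ->
  (forall z, UHP z -> 0 <= h z) ->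
  (Vint a (@UHP R) (fun z => (`|f z * sig z| `^ p)%:E) <= (S `^ p)%:E)%E ->
  (Vint a (@UHP R) (fun z => (h z `^ q')%:E) <= (T `^ q')%:E)%E ->
  (\sum_(j <- dyadic n i) ((j.2 `^ (2 + a - g))^-1)%:E *
   (Vint a (hbox j) (fun z => (om z * h z)%:E) * Vint a (hbox j) (fun z => `|f z|%:E))
   <= (M * (S * T))%:E)%E.
Proof.
have p0 : 0 < p := lt_trans ltr01 p1.
have q'0 : 0 < q' by apply: lt_trans q'1.
have [K1 [K10 HK1]] := orlicz_carleson a1 p1 bPhi.
have [K2 [K20 HK2]] := orlicz_carleson a1 q'1 bPsi.
have A0 : 0 < 16 * C * (a + 1) `^ (g / (2 + a) - 1).
  by rewrite !mulr_gt0// powR_gt0//; move: (a) a1 => a' a1'; lra.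
set A := 16 * C * _ in A0.
exists (A * (K1 `^ p^-1 * K2 `^ q'^-1)); split.
  by rewrite mulr_gt0// mulr_gt0 ?powR_gt0.
move=> f h S T n i i0 S0 T0 mf mh h0 Sf Th.
have msig := weight_measurable wsig.
pose F z := `|f z * sig z|.
have mF : measurable_fun (@UHP R) F by apply: measurable_normr_fun; exact: measurable_funM.
have F0 z : UHP z -> 0 <= F z by rewrite /F.
have c1 := HK1 F mF F0 n i i0; have c2 := HK2 h mh h0 n i i0.
pose xx j := volume a j.2 `^ p^-1 * orlicz_norm a Phic F j.
pose yy j := volume a j.2 `^ q'^-1 * orlicz_norm a Psic h j.
apply: (@le_trans _ _ (\sum_(j <- dyadic n i) (A * (xx j * yy j))%:E)%E).
  rewrite big_seq [leRHS]big_seq; apply: lee_sum => j jn.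
  apply: box_bound => //; first exact: dyadic_gt0 jn.
    by apply: le_lt_trans Sf _; rewrite ltry.
  by apply: le_lt_trans Th _; rewrite ltry.
rewrite sumEFin lee_fin -mulr_sumr -mulrA ler_wpM2l ?(ltW A0)//.
rewrite (_ : _ * _ * _ = (K1 `^ p^-1 * S) * (K2 `^ q'^-1 * T)); last by ring.
have pw (K s r v : R) : 0 < r -> 0 <= K -> 0 <= v -> (K `^ r^-1 * v) `^ r = K * v `^ r.
  move=> r0 K0 v0; rewrite powRM ?powR_ge0// -powRrM mulVf ?gt_eqF// powRr1//.
apply: (sum_mul_le p0 pq q'0 qq'); rewrite ?mulr_gt0 ?powR_gt0//.
- by move=> j _; rewrite mulr_ge0 ?powR_ge0// orlicz_norm_ge0.
- by move=> j _; rewrite mulr_ge0 ?powR_ge0// orlicz_norm_ge0.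
- rewrite pw// ?(ltW K10) ?(ltW S0)// -lee_fin EFinM.
  apply: le_trans (lee_wpmul2l _ Sf); last by rewrite lee_fin ltW.
  apply: le_trans c1; rewrite lee_fin big_seq [leRHS]big_seq; apply: ler_sum => j jn.
  by rewrite pw ?orlicz_norm_ge0// ltW// volume_gt0// (dyadic_gt0 i0 jn).
- rewrite pw// ?(ltW K20) ?(ltW T0)// -lee_fin EFinM.
  apply: le_trans (lee_wpmul2l _ Th); last by rewrite lee_fin ltW.
  apply: le_trans c2; rewrite lee_fin big_seq [leRHS]big_seq; apply: ler_sum => j jn.
  by rewrite pw ?orlicz_norm_ge0// ltW// volume_gt0// (dyadic_gt0 i0 jn).
Qed.

End tree_bound.
End bilinear.

(** * The operator cut to a compact rectangle *)

Section cut_operator.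
Context {R : realType}.
Implicit Types (a g : R) (f : R * R -> R) (z w : R * R) (N : nat).

(* Unlike [ge0_le_integral], requires no measurability. *)
Lemma le_integral_ge0 d (T : measurableType d) (mu : {measure set T -> \bar R})
    (D : set T) (f1 f2 : T -> \bar R) :
  (forall x, D x -> 0 <= f1 x)%E -> (forall x, D x -> f1 x <= f2 x)%E ->
  (\int[mu]_(x in D) f1 x <= \int[mu]_(x in D) f2 x)%E.
Proof.
move=> f10 f12.
have f20 x : D x -> (0 <= f2 x)%E by move=> Dx; exact: le_trans (f10 x Dx) (f12 x Dx).
rewrite !ge0_integralE//; apply: ereal_sup_le => _ /= [h hf <-].
exists h => // x; apply: le_trans (hf x) _.
by rewrite /patch; case: ifPn => // /set_mem; exact: f12.
Qed.

Let leb2_sigma_finite : sigma_finite setT (@leb2 R).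
Proof.
pose I n : set R := `[- n%:R, n%:R]%classic.
exists (fun n => I n `*` I n).
  apply/seteqP; split => // -[x y] _.
  exists (Num.bound (Num.max `|x| `|y|)) => //.
  have := archi_boundP (_ : 0 <= Num.max `|x| `|y|).
  rewrite le_max normr_ge0 => /(_ isT); rewrite gt_max !ltr_norml.
  by move=> /andP[/andP[? ?] /andP[? ?]]; split; rewrite /I /= in_itv/= !ltW.
have mI n : measurable (I n) by exact: measurable_itv.
move=> n; split; first by apply: measurableX; exact: mI.
rewrite [X in (X < _)%E](@product_measure1E _ _ _ _ _ lebesgue_measure lebesgue_measure); [|exact: mI|exact: mI].
rewrite /= !lebesgue_measure_itv/= lte_fin; case: ifPn => _; last by rewrite mul0e.
by rewrite -EFinB -EFinM ltry.
Qed.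

(* The library's sigma-finite instance on [\x] is shadowed by the one for
   subprobabilities, so unification does not find it. *)
HB.instance Definition _ :=
  Measure.copy (@leb2 R) (@lebesgue_measure R \x @lebesgue_measure R)%E.

HB.instance Definition _ :=
  Measure_isSigmaFinite.Build _ _ _ (@leb2 R) leb2_sigma_finite.

Lemma kern_ge0 a g z w : 0 <= kern a g z w.
Proof. by rewrite /kern invr_ge0 powR_ge0. Qed.

Lemma measurable_kern a g :
  measurable_fun setT (fun zw : (R * R) * (R * R) => kern a g zw.1 zw.2).
Proof.
apply: measurable_inv_ge0; [exact: measurableT| |by move=> zw _; exact: powR_ge0].
apply: (measurableT_comp (measurable_powR (2 + a - g))).
have msqrt : measurable_fun [set: R] (fun x : R => Num.sqrt x).
  by apply: continuous_measurable_fun => x; exact: sqrt_continuous.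
apply: (measurableT_comp msqrt).
apply: measurable_funD; apply: measurable_funX.
  by apply: measurable_funB; apply: measurableT_comp.
by apply: measurable_funD; apply: measurableT_comp.
Qed.

Definition Tcut a g N f z : \bar R :=
  Vint a (core N) (fun w => (`|f w| * kern a g z w)%:E).

Lemma Tcut_ge0 a g N f z : (0 <= Tcut a g N f z)%E.
Proof. by apply: Vint_ge0 => w _; rewrite lee_fin mulr_ge0// kern_ge0. Qed.

Lemma measurable_kern_section a g (D : set (R * R)) z :
  measurable_fun D (fun w => kern a g z w).
Proof.
apply: measurable_funTS.
exact: (measurableT_comp (measurable_kern a g) (measurable_pair1 z)).
Qed.

Lemma measurable_abs_kern a g (D : set (R * R)) f z : measurable_fun D f ->
  measurable_fun D (fun w => (`|f w| * kern a g z w)%:E).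
Proof.
move=> mf; apply/measurable_EFinP; apply: measurable_funM.
  exact: measurable_normr_fun.
exact: measurable_kern_section.
Qed.

(** The weight, [|f|] and the restriction to the core are gathered in [phi], so that the integrand
    is nonnegative and jointly measurable on the product and Tonelli's theorem applies. *)
Lemma measurable_Tcut a g N f : measurable_fun (@UHP R) f ->
  measurable_fun setT (Tcut a g N.+1 f).
Proof.
move=> mf.
pose phi := (fun w : R * R => (w.2 `^ a)%:E * `|f w|%:E)%E \_ (core N.+1).
have mphi : measurable_fun setT phi.
  apply/(measurable_restrictT _ _).1; first exact: measurable_core.
  apply: measurable_weighted; first exact: measurable_core.
  apply/measurable_EFinP; apply: measurable_normr_fun.
  by apply: measurable_funS mf; [exact: measurable_UHP|exact: core_sub_UHP].
have phi0 w : (0 <= phi w)%E.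
  by apply: erestrict_ge0 => u _; rewrite mule_ge0 ?lee_fin ?powR_ge0.
pose H (zw : (R * R) * (R * R)) := (phi zw.2 * (kern a g zw.1 zw.2)%:E)%E.
have mH : measurable_fun setT H.
  apply: emeasurable_funM; first exact: measurableT_comp.
  by apply/measurable_EFinP; exact: measurable_kern.
have H0 zw : (0 <= H zw)%E by rewrite mule_ge0// lee_fin kern_ge0.
have : measurable_fun setT (fun z : R * R =>
    \int[@leb2 R]_w H (z, w))%E.
  exact: (@measurable_fun_fubini_tonelli_F _ _ _ _ R (@leb2 R) H mH H0).
congr (measurable_fun _ _); apply/funext => z.
rewrite /Tcut /Vint [RHS]integral_mkcond; apply: eq_integral => w _.
rewrite /H /phi /patch /=; case: ifP => _; last by rewrite mul0e.
by rewrite EFinM muleA.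
Qed.

Lemma Tcut_le_grids a g N f z : (0 < N)%N -> g < 2 + a ->
  measurable_fun (@UHP R) f -> core N z -> core N `<=` @UHP R ->
  (Tcut a g N f z <= \sum_(j <- grids N)
     ((6 `^ (2 + a - g) * (j.2 `^ (2 + a - g))^-1 * \1_(hbox j) z)%:E *
      Vint a (hbox j) (fun w => `|f w|%:E)))%E.
Proof.
move=> N0 ga mf zN NU.
have mN := @measurable_core R N; have mU := @measurable_UHP R.
have mfa : measurable_fun (@UHP R) (fun w => `|f w|%:E).
  by apply/measurable_EFinP; exact: measurable_normr_fun.
pose c (j : R * R) := 6 `^ (2 + a - g) * (j.2 `^ (2 + a - g))^-1 * \1_(hbox j) z.
have c0 j : 0 <= c j by rewrite !mulr_ge0 ?invr_ge0 ?powR_ge0.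
have mi (j : R * R) D : measurable_fun D (fun w : R * R => (\1_(hbox j) w)%:E : \bar R).
  by apply/measurable_EFinP; apply: measurable_indic; exact: measurable_hbox.
have mif (j : R * R) : measurable_fun (@UHP R) (fun w => (\1_(hbox j) w)%:E * `|f w|%:E)%E.
  exact: emeasurable_funM.
have mifN (j : R * R) : measurable_fun (core N) (fun w => (\1_(hbox j) w)%:E * `|f w|%:E)%E.
  exact: measurable_funS (mif j).
have if0 (j : R * R) w : (0 <= (\1_(hbox j) w)%:E * `|f w|%:E)%E.
  by rewrite mule_ge0 ?lee_fin.
apply: (@le_trans _ _ (Vint a (core N) (fun w =>
    \sum_(j <- grids N) (c j)%:E * ((\1_(hbox j) w)%:E * `|f w|%:E))%E)).
  apply: le_Vint => //.
  - by apply: measurable_abs_kern; exact: measurable_funS mf.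
  - apply: emeasurable_sum => j; apply: emeasurable_funM => //; exact: measurable_cst.
  - by move=> w _; rewrite lee_fin mulr_ge0// kern_ge0.
  - move=> w wN; under eq_bigr do rewrite -!EFinM.
    rewrite sumEFin lee_fin.
    apply: le_trans (ler_wpM2l (normr_ge0 (f w)) (kern_le_grids N0 ga zN wN)) _.
    rewrite !mulr_sumr; apply: ler_sum => j _; rewrite /c.
    by rewrite le_eqVlt; apply/orP; left; apply/eqP; ring.
rewrite Vint_sum//; last 2 first.
- by move=> j; apply: emeasurable_funM => //; exact: measurable_cst.
- by move=> j w _; rewrite mule_ge0// lee_fin.
apply: lee_sum => j _; rewrite VintZl ?lee_fin//.
rewrite lee_wpmul2l ?lee_fin// [leRHS](Vint_indic _ _ mU (measurable_hbox _) (@hbox_sub_UHP _ _)).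
exact: subset_Vint.
Qed.

(** The kernel bound separates the variables: each box contributes a product of two integrals, which
    is the form treated by [tree_bound]. *)
Lemma cut_form_le a g N f (v : R * R -> R) : g < 2 + a ->
  measurable_fun (@UHP R) f -> measurable_fun (@UHP R) v ->
  (forall z, UHP z -> 0 <= v z) ->
  (Vint a (core N.+1) (fun z => (v z)%:E * Tcut a g N.+1 f z)%E <=
   (6 `^ (2 + a - g))%:E *
   \sum_(j <- grids N.+1) ((j.2 `^ (2 + a - g))^-1)%:E *
     (Vint a (hbox j) (fun z => (v z)%:E) * Vint a (hbox j) (fun z => `|f z|%:E)))%E.
Proof.
move=> ga mf mv v0.
have NU := @core_sub_UHP R N.
have mN := @measurable_core R N.+1; have mU := @measurable_UHP R.
pose Y (j : R * R) := Vint a (hbox j) (fun w => `|f w|%:E).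
have Y0 j : (0 <= Y j)%E by apply: Vint_ge0 => w _; rewrite lee_fin.
pose c (j : R * R) : R := 6 `^ (2 + a - g) * (j.2 `^ (2 + a - g))^-1.
have c0 j : 0 <= c j by rewrite mulr_ge0 ?invr_ge0 ?powR_ge0.
have mvE : measurable_fun (@UHP R) (fun z => (v z)%:E) by exact/measurable_EFinP.
have mi (j : R * R) D : measurable_fun D (fun w : R * R => (\1_(hbox j) w)%:E : \bar R).
  by apply/measurable_EFinP; apply: measurable_indic; exact: measurable_hbox.
have miv (j : R * R) : measurable_fun (@UHP R) (fun w => (\1_(hbox j) w)%:E * (v w)%:E)%E.
  exact: emeasurable_funM.
have iv0 (j : R * R) w : UHP w -> (0 <= (\1_(hbox j) w)%:E * (v w)%:E)%E.
  by move=> Uw; rewrite mule_ge0 ?lee_fin ?v0.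
have cY0 j : (0 <= (c j)%:E * Y j)%E by rewrite mule_ge0 ?lee_fin.
pose G (z : R * R) := (\sum_(j <- grids N.+1)
    ((c j)%:E * Y j) * ((\1_(hbox j) z)%:E * (v z)%:E))%E.
have mG : measurable_fun (@UHP R) G.
  by apply: emeasurable_sum => j; apply: emeasurable_funM => //; exact: measurable_cst.
have G0 z : UHP z -> (0 <= G z)%E.
  by move=> Uz; apply: sume_ge0 => j _; rewrite mule_ge0// iv0.
apply: (@le_trans _ _ (Vint a (core N.+1) G)).
  apply: le_Vint => //.
  - apply: emeasurable_funM; first exact: measurable_funS mvE.
    exact: measurable_funTS (measurable_Tcut _ _ _ mf).
  - exact: measurable_funS mG.
  - by move=> z /NU Uz; rewrite mule_ge0 ?Tcut_ge0// lee_fin v0.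
  - move=> z zN; have Uz := NU _ zN.
    have v0' : (0 <= (v z)%:E)%E by rewrite lee_fin v0.
    apply: le_trans (lee_wpmul2l v0' (Tcut_le_grids (ltn0Sn N) ga mf zN NU)) _.
    rewrite ge0_sume_distrr; last first.
      move=> j _; apply: mule_ge0; last exact: Y0.
      by rewrite lee_fin !mulr_ge0 ?invr_ge0 ?powR_ge0.
    apply: lee_sum => j _; rewrite -/(c j) EFinM -/(Y j).
    rewrite le_eqVlt; apply/orP; left; apply/eqP.
    by rewrite muleC -!muleA; congr (_ * _)%E; rewrite muleCA.
apply: le_trans (subset_Vint _ mN mU NU mG G0) _.
rewrite Vint_sum//; last 2 first.
- by move=> j; apply: emeasurable_funM => //; exact: measurable_cst.
- by move=> j z Uz; rewrite mule_ge0// iv0.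
rewrite ge0_sume_distrr; last first.
  move=> j _; rewrite mule_ge0 ?lee_fin ?invr_ge0 ?powR_ge0// mule_ge0//; last exact: Y0.
  by apply: Vint_ge0 => z /hbox_sub_UHP/v0 vz; rewrite lee_fin.
apply: lee_sum => j _; rewrite VintZl//; last exact: iv0.
rewrite -(Vint_indic _ _ mU (measurable_hbox _) (@hbox_sub_UHP _ _)).
rewrite /c EFinM -/(Y j) le_eqVlt; apply/orP; left; apply/eqP.
by rewrite -!muleA; congr (_ * (_ * _))%E; rewrite muleC.
Qed.

End cut_operator.

(** * Duality on a compact rectangle *)

Section duality.
Context {R : realType}.

Lemma powR_self_bound (q q' x A : R) : 0 < q -> 0 < q' -> q^-1 + q'^-1 = 1 ->
  0 < x -> x <= A * x `^ q'^-1 -> x <= A `^ q.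
Proof.
move=> q0 q'0 qq' x0 H.
have xq : x `^ q^-1 <= A.
  rewrite -(@ler_pM2r _ (x `^ q'^-1)) ?powR_gt0// -powRD; last by rewrite (gt_eqF x0) implybT.
  by rewrite qq' powRr1// ltW.
have A0 : 0 <= A by apply: le_trans xq; exact: powR_ge0.
have -> : x = (x `^ q^-1) `^ q by rewrite -powRrM mulVf ?gt_eqF// powRr1// ltW.
by rewrite ge0_ler_powR ?nnegrE ?powR_ge0// ltW.
Qed.

Lemma poweR_le_root (q b : R) (y : \bar R) : 0 < q -> (0 <= y)%E ->
  (y `^ q <= b%:E)%E -> (y <= (b `^ q^-1)%:E)%E.
Proof.
move=> q0; case: y => [y| |]//=.
  rewrite !lee_fin => y0 yb.
  have -> : y = (y `^ q) `^ q^-1 by rewrite -powRrM mulfV ?gt_eqF// powRr1.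
  by rewrite ge0_ler_powR ?nnegrE ?powR_ge0 ?invr_ge0 ?(ltW q0)// (le_trans _ yb)// powR_ge0.
by rewrite (gt_eqF q0) => _; rewrite leye_eq.
Qed.

Lemma Vint_core_lty (a : R) N : -1 < a -> (Vint a (@core R N.+1) (fun=> 1) < +oo)%E.
Proof.
move=> a1; have n0 : 0 < N.+1%:R :> R by [].
have h : - N.+1%:R < N.+1%:R + 1 :> R by lra.
apply: (@le_lt_trans _ _ (Vmeas a (Qbox (- N.+1%:R) (N.+1%:R + 1)))).
  apply: subset_Vint => //; [exact: measurable_core|exact: measurable_Qbox|].
  move=> z zN; have := core_sub_UHP zN; case: zN => /andP[h1 h2] /andP[_ h4].
  by rewrite /UHP /= => z0; split; apply/andP; split; lra.
by rewrite Vmeas_Qbox// ltry.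
Qed.

(* Duality, with [h = (min (om T f) n)^(q-1)] on a compact set; the truncation makes
   the [q]-th power integral finite, so that it can be divided out. *)
Lemma cut_bound (a g p q : R) (Phi Psi Phic Psic : R -> R)
    (om sig : R * R -> R) (C : R) :
  -1 < a -> g < 2 + a -> 1 < p -> p <= q -> Young Phi -> Young Psi ->
  complementary Phi Phic -> complementary Psi Psic ->
  B_class p Phic -> B_class (q / (q - 1)) Psic ->
  weight om -> weight sig -> 0 < C ->
  (forall x1 x2 : R, x1 < x2 ->
     ((Vmeas a (Qbox x1 x2)) `^ (g / (2 + a) + q^-1 - p^-1) *
      Luxemburg a Psi (Qbox x1 x2) (fun z => (om z)%:E) *
      Luxemburg a Phi (Qbox x1 x2) (sigma_inv sig) <= C%:E)%E) ->
  exists K : R, 0 < K /\ forall (f : R * R -> R) (S : R) (N : nat), 0 < S -> measurable_fun (@UHP R) f ->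
    (Vint a (@UHP R) (fun z => (`|f z * sig z| `^ p)%:E) <= (S `^ p)%:E)%E ->
    (Vint a (core N.+1) (fun z =>
       mine ((om z)%:E * Tcut a g N.+1 f z) N.+1%:R%:E `^ q) <= ((K * S) `^ q)%:E)%E.
Proof.
move=> a1 ga p1 pq yPhi yPsi cPhi cPsi bPhi bPsi wom wsig C0 bump.
have [M [M0 HM]] := tree_bound a1 p1 pq yPhi yPsi cPhi cPsi bPhi bPsi wom wsig C0 bump.
have mom := weight_measurable wom; have [om0 _] := wom.
set q' := q / (q - 1) in bPsi HM *.
have q0 : 0 < q by lra.
have q1 : 0 < q - 1 by lra.
have q'0 : 0 < q' by rewrite divr_gt0.
have qq' : q^-1 + q'^-1 = 1 by rewrite /q' invf_div; field; rewrite gt_eqF.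
have q1q' : (q - 1) * q' = q by rewrite /q' mulrC divfK// gt_eqF.
clearbody q'.
(* One [M] for each of the two grids, and the power of 6 from [kern_le_grids]. *)
pose B := 6 `^ (2 + a - g) * (M + M).
have B0 : 0 < B by rewrite mulr_gt0 ?powR_gt0// addr_gt0.
exists B; split => // f S N S0 mf Sf.
have mU := @measurable_UHP R; have mN := @measurable_core R N.+1.
have NU := @core_sub_UHP R N.
have n0 : 0 < N.+1%:R :> R by [].
pose W z := ((om z)%:E * Tcut a g N.+1 f z)%E.
have W0 z : UHP z -> (0 <= W z)%E by move=> Uz; rewrite mule_ge0 ?Tcut_ge0// lee_fin om0.
have mW : measurable_fun (@UHP R) W.
  apply: emeasurable_funM; first exact/measurable_EFinP.
  exact: measurable_funTS (measurable_Tcut _ _ _ mf).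
pose G z := fine (mine (W z) N.+1%:R%:E).
have mmin : measurable_fun (@UHP R) (fun z => mine (W z) N.+1%:R%:E).
  by apply: measurable_mine => //; exact: measurable_cst.
have min0 z : UHP z -> (0 <= mine (W z) N.+1%:R%:E)%E.
  by move=> Uz; rewrite le_min W0//= lee_fin ltW.
have GE z : UHP z -> (G z)%:E = mine (W z) N.+1%:R%:E.
  move=> Uz; rewrite fineK// ge0_fin_numE ?min0//.
  by apply: le_lt_trans (ltry N.+1%:R); rewrite ge_min lexx orbT.
have G0 z : UHP z -> 0 <= G z by move=> Uz; rewrite -lee_fin GE ?min0.
have GN z : UHP z -> G z <= N.+1%:R.
  by move=> Uz; rewrite -lee_fin GE// ge_min lexx orbT.
have mG : measurable_fun (@UHP R) G.
  exact: (measurableT_comp (@fine_measurable R setT measurableT)).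
have mGr r : measurable_fun (@UHP R) (fun z => G z `^ r).
  exact: (measurableT_comp (measurable_powR r)).
(* As [(q - 1) * q' = q], the [q']-th power of [h] integrates to [X] itself, and the estimate closes
   up as [X <= B * S * X ^ (1/q')]. *)
pose h z := \1_(core N.+1) z * G z `^ (q - 1).
have mh : measurable_fun (@UHP R) h.
  by apply: measurable_funM => //; exact: measurable_indic.
have h0 z : UHP z -> 0 <= h z by move=> _; rewrite mulr_ge0 ?powR_ge0.
set X := Vint _ _ _.
have XE : X = Vint a (core N.+1) (fun z => (G z `^ q)%:E).
  by apply: eq_Vint => z /NU Uz; rewrite -/(W z) -GE// poweR_EFin.
have hX : Vint a (@UHP R) (fun z => (h z `^ q')%:E) = X.
  rewrite XE (Vint_indic _ _ mU mN NU); apply: eq_Vint => z Uz.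
  rewrite -EFinM /h indicE; case: (z \in core N.+1).
    by rewrite !mul1r -powRrM q1q'.
  by rewrite !mul0r powR0// gt_eqF.
have X0 : (0 <= X)%E by apply: Vint_ge0 => z _; exact: poweR_ge0.
have mGq : measurable_fun (core N.+1) (fun z => (G z `^ q)%:E).
  by apply/measurable_EFinP; exact: measurable_funS (mGr q).
have Xoo : (X < +oo)%E.
  apply: (@le_lt_trans _ _ (Vint a (core N.+1) (fun z => (N.+1%:R `^ q)%:E * 1)%E)).
    rewrite XE; apply: le_Vint => //.
    - by move=> z _; rewrite lee_fin powR_ge0.
    - move=> z /NU Uz; rewrite mule1 lee_fin ge0_ler_powR ?nnegrE ?(ltW q0) ?(ltW n0) ?G0 ?GN//.
  rewrite VintZl//.
  by rewrite lte_mul_pinfty ?lee_fin ?powR_ge0 ?Vint_core_lty.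
have Xform : (X <= Vint a (core N.+1) (fun z => (om z * h z)%:E * Tcut a g N.+1 f z)%E)%E.
  rewrite XE; apply: le_Vint => //.
  - apply: emeasurable_funM.
      apply/measurable_EFinP; apply: measurable_funM.
        exact: measurable_funS mom.
      exact: measurable_funS mh.
    exact: measurable_funTS (measurable_Tcut _ _ _ mf).
  - by move=> z _; rewrite lee_fin powR_ge0.
  - move=> z zN; have Uz := NU _ zN.
    rewrite /h indicE mem_set// mul1r.
    have -> : ((om z * G z `^ (q - 1))%:E * Tcut a g N.+1 f z =
        (G z `^ (q - 1))%:E * W z)%E by rewrite EFinM /W muleCA muleA.
    rewrite -mulr_powRB1 ?G0// mulrC EFinM lee_wpmul2l ?lee_fin ?powR_ge0//.
    by rewrite GE// ge_min lexx.
have XF : X = (fine X)%:E by rewrite fineK// ge0_fin_numE.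
have x0 : 0 <= fine X by rewrite fine_ge0.
move: x0; rewrite le_eqVlt => /predU1P[x0|x0].
  by rewrite XF -x0 lee_fin powR_ge0.
pose T := fine X `^ q'^-1.
have T0 : 0 < T by rewrite powR_gt0.
have TX : (Vint a (@UHP R) (fun z => (h z `^ q')%:E) <= (T `^ q')%:E)%E.
  by rewrite hX XF lee_fin /T -powRrM mulVf ?gt_eqF// powRr1// ltW.
rewrite XF lee_fin; apply: (powR_self_bound q0 q'0 qq' x0).
rewrite -lee_fin -XF; apply: le_trans Xform _.
have momh0 z : UHP z -> 0 <= om z * h z by move=> Uz; rewrite mulr_ge0 ?om0 ?h0.
apply: le_trans (cut_form_le N ga mf (measurable_funM mom mh) momh0) _.
have -> : B * S * T = 6 `^ (2 + a - g) * (M * (S * T) + M * (S * T)) by rewrite /B; ring.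
rewrite EFinM lee_wpmul2l ?lee_fin ?powR_ge0// EFinD.
have HM' i : 0 < i.2 -> _ := fun i0 => HM f h S T (3 * N.+1 ^ 2)%N i i0 S0 T0 mf mh h0 Sf TX.
move: HM'; rewrite /grids; move: (3 * N.+1 ^ 2)%N => n HM'.
by rewrite big_cat; apply: leeD; apply: HM' => /=; rewrite mulr_gt0.
Qed.

End duality.

(** * Passage from compact rectangles to the half-plane *)

Section exhaustion.
Context {R : realType}.
Variables (a g : R) (f : R * R -> R).
Hypothesis mf : measurable_fun (@UHP R) f.

(** [f] is signed, so cuts of [Tag] itself need not be monotone; [|Tag|] is first bounded by the
    integral with [|f|], which is the increasing limit of [Tcut]. *)
Lemma Tag_le (z : R * R) (b : \bar R) n : UHP z ->
  (forall N, (n <= N)%N -> (Tcut a g N.+1 f z <= b)%E) -> (`|Tag a g f z| <= b)%E.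
Proof.
move=> Uz Hb; have mU := @measurable_UHP R.
have mk : measurable_fun (@UHP R) (fun w => kern a g z w).
  exact: measurable_kern_section.
apply: (@le_trans _ _ (Vint a (@UHP R) (fun w => (`|f w| * kern a g z w)%:E))).
  rewrite /Tag /Vint; apply: (le_trans (le_abse_integral (@leb2 R) mU _)).
    by apply: measurable_weighted => //; apply/measurable_EFinP; exact: measurable_funM.
  rewrite le_eqVlt; apply/orP; left; apply/eqP; apply: eq_integral => w _.
  by rewrite -!EFinM/= normrM [`|_ `^ _|]ger0_norm ?powR_ge0// normrM [`|kern _ _ _ _|]ger0_norm ?kern_ge0.
have mw D : D `<=` @UHP R -> measurable_fun D
    (fun w => (w.2 `^ a)%:E * (`|f w| * kern a g z w)%:E)%E.
  move=> DU; apply: (measurable_funS mU DU); apply: measurable_weighted => //.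
  exact: measurable_abs_kern.
have cvgT : Tcut a g N.+1 f z @[N --> \oo] -->
    Vint a (@UHP R) (fun w => (`|f w| * kern a g z w)%:E).
  rewrite /Tcut /Vint -{1}bigcup_core; apply: ge0_nondecreasing_set_cvg_integral.
  - by move=> m k mk'; apply/subsetPset; apply: core_mono.
  - by move=> k; exact: measurable_core.
  - by move=> k; apply: mw; exact: core_sub_UHP.
  - by move=> k w _; rewrite mule_ge0 ?lee_fin ?powR_ge0// mulr_ge0// kern_ge0.
rewrite -(cvg_lim _ cvgT)//; apply: lime_le; first by apply/cvg_ex; eexists; exact: cvgT.
by exists n => // N /=; exact: Hb.
Qed.

Lemma Tcut_mono (z : R * R) m n : (m <= n)%N ->
  (Tcut a g m.+1 f z <= Tcut a g n.+1 f z)%E.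
Proof.
move=> mn; apply: subset_Vint; try exact: measurable_core.
- exact: core_mono.
- apply: measurable_abs_kern; apply: measurable_funS mf; first exact: measurable_UHP.
  exact: core_sub_UHP.
- by move=> w _; rewrite lee_fin mulr_ge0// kern_ge0.
Qed.

Variables (q : R) (om : R * R -> R).
Hypotheses (q0 : 0 < q) (wom : weight om).

Let om0 z : UHP z -> (0 <= (om z)%:E)%E.
Proof. by case: wom => h _ /h; rewrite lee_fin. Qed.

(** The full integrand with weight and indicator: core, cut operator and truncation height all
    increase with [N], as monotone convergence requires. *)
Let W N (z : R * R) : \bar R := ((z.2 `^ a)%:E * ((\1_(core N.+1) z)%:E *
  mine ((om z)%:E * Tcut a g N.+1 f z) N.+1%:R%:E `^ q))%E.

Let min_ge0 N z : UHP z -> (0 <= mine ((om z)%:E * Tcut a g N.+1 f z) N.+1%:R%:E)%E.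
Proof. by move=> Uz; rewrite le_min mule_ge0 ?Tcut_ge0 ?om0//= lee_fin. Qed.

Let W0 N z : (0 <= W N z)%E.
Proof. by rewrite mule_ge0 ?lee_fin ?powR_ge0// mule_ge0 ?lee_fin ?poweR_ge0. Qed.

Let mWw N : measurable_fun (@UHP R) (fun z => (\1_(core N.+1) z)%:E *
  mine ((om z)%:E * Tcut a g N.+1 f z) N.+1%:R%:E `^ q)%E.
Proof.
apply: emeasurable_funM.
  by apply/measurable_EFinP; apply: measurable_indic; exact: measurable_core.
apply: (measurableT_comp (measurable_poweR q)).
apply: measurable_mine; last exact: measurable_cst.
apply: emeasurable_funM; first by apply/measurable_EFinP; exact: weight_measurable.
exact: measurable_funTS (measurable_Tcut _ _ _ mf).
Qed.

Let W_mono z : UHP z -> {homo W^~ z : m n / (m <= n)%N >-> (m <= n)%E}.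
Proof.
move=> Uz m n mn; rewrite lee_wpmul2l ?lee_fin ?powR_ge0//.
apply: lee_pmul; rewrite ?lee_fin ?poweR_ge0//.
  rewrite !indicE; have [/set_mem zm|_] := boolP (z \in core m.+1) => //.
  by rewrite mem_set//; exact: (core_mono _ _ zm).
apply: gt0_ler_poweR; rewrite ?(ltW q0)// ?in_itv/= ?min_ge0 ?leey//.
apply: le_min2; last by rewrite lee_fin ler_nat.
by rewrite lee_wpmul2l ?om0// Tcut_mono.
Qed.

Let W_lim z : UHP z ->
  ((z.2 `^ a)%:E * ((om z)%:E * `|Tag a g f z|) `^ q <= limn (W^~ z))%E.
Proof.
move=> Uz; have cv := ereal_nondecreasing_cvgn (W_mono Uz).
rewrite (cvg_lim _ cv)//.
have WL N : (W N z <= ereal_sup (range (W^~ z)))%E by apply: ereal_sup_ubound; exists N.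
move: (ereal_sup _) WL => L WL.
have c0 : 0 < z.2 `^ a by rewrite powR_gt0.
case: L WL => [r| |] WL; [|by rewrite leey|].
  (* When the limit is a finite [r], every minimum is at most [b] from [core_exhaust] on; once
     [N.+1 > b], that minimum cannot be the truncation height, so [om * Tcut] itself is at most
     [b]. *)
  have r0 : 0 <= r by rewrite -lee_fin; exact: le_trans (W0 0%N z) (WL 0%N).
  pose b := (r / z.2 `^ a) `^ q^-1.
  have b0 : 0 <= b by exact: powR_ge0.
  have [n0 Hn0] := core_exhaust Uz.
  pose n := maxn n0 (Num.bound b).
  have key N : (n <= N)%N -> ((om z)%:E * Tcut a g N.+1 f z <= b%:E)%E.
    rewrite geq_max => /andP[nN bN].
    have bN' : b < N.+1%:R.
      by apply: lt_le_trans (archi_boundP b0) _; rewrite ler_nat ltnW.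
    have := WL N; rewrite /W indicE mem_set ?mul1e; last exact: Hn0.
    rewrite -lee_pdivlMl// -EFinM mulrC => H.
    have := poweR_le_root q0 (min_ge0 N Uz) H; rewrite -/b ge_min => /orP[//|].
    by rewrite lee_fin leNgt bN'.
  have Tb : ((om z)%:E * `|Tag a g f z| <= b%:E)%E.
    (* If [om z] is 0 the product is 0 even for an infinite [Tag]; otherwise [om z] can be divided
       out. *)
    have := om0 Uz; rewrite lee_fin le_eqVlt => /predU1P[<-|o0].
      by rewrite mul0e lee_fin.
    rewrite -lee_pdivlMl//; apply: (Tag_le (n := n) Uz) => N nN.
    by rewrite lee_pdivlMl// key.
  rewrite -lee_pdivlMl//.
  apply: (@le_trans _ _ (b%:E `^ q)%E).
    apply: gt0_ler_poweR; rewrite ?(ltW q0)// ?in_itv/= ?leey ?andbT//.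
    by rewrite mule_ge0 ?om0.
  rewrite poweR_EFin -EFinM lee_fin /b -powRrM mulVf ?gt_eqF// powRr1.
    by rewrite mulrC.
  by rewrite divr_ge0// ltW.
by have := le_trans (W0 0%N z) (WL 0%N).
Qed.

Lemma Vint_Tag_le (B : R) :
  (forall N, Vint a (core N.+1) (fun z =>
     mine ((om z)%:E * Tcut a g N.+1 f z) N.+1%:R%:E `^ q) <= B%:E)%E ->
  (Vint a (@UHP R) (fun z => ((om z)%:E * `|Tag a g f z|) `^ q) <= B%:E)%E.
Proof.
move=> HB; have mU := @measurable_UHP R.
apply: (@le_trans _ _ (\int[@leb2 R]_(z in @UHP R) limn (W^~ z))%E).
  apply: le_integral_ge0 => z Uz; last exact: W_lim.
  by rewrite mule_ge0 ?lee_fin ?powR_ge0 ?poweR_ge0.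
have mW N : measurable_fun (@UHP R) (W N) by exact: measurable_weighted.
rewrite monotone_convergence//.
apply: lime_le.
  apply: ereal_nondecreasing_is_cvgn => m n mn.
  apply: ge0_le_integral; [exact: mU| |exact: mW|exact: mW|].
    by move=> z _; exact: W0.
  by move=> z Uz; exact: (W_mono Uz).
apply: nearW => N; apply: le_trans (HB N).
by rewrite [leRHS](Vint_indic _ _ mU (measurable_core _) (@core_sub_UHP _ _)).
Qed.

End exhaustion.

(** * The two-weight inequality *)

Unset Implicit Arguments.

Theorem theorem2p7 (R : realType) (a g p q : R) (Phi Psi : R -> R)
    (om sig : R * R -> R) (C : R) :
  -1 < a -> 0 <= g -> g < 2 + a -> 1 < p -> p <= q ->
  Young Phi -> Young Psi ->
  (exists Phic, complementary Phi Phic /\ B_class p Phic) ->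
  (exists Psic, complementary Psi Psic /\ B_class (q / (q - 1)) Psic) ->
  weight om -> weight sig -> 0 < C ->
  (forall x1 x2 : R, x1 < x2 ->
     ((Vmeas a (Qbox x1 x2)) `^ (g / (2 + a) + q^-1 - p^-1) *
      Luxemburg a Psi (Qbox x1 x2) (fun z => (om z)%:E) *
      Luxemburg a Phi (Qbox x1 x2) (sigma_inv sig) <= C%:E)%E) ->
  exists K : R, 0 < K /\
    forall f : R * R -> R, measurable_fun (@UHP R) f ->
      (Vint a (@UHP R) (fun z => (`|f z * sig z|%:E) `^ p) < +oo)%E ->
      ((Vint a (@UHP R) (fun z => ((om z)%:E * `|Tag a g f z|) `^ q)) `^ (q^-1)
        <= K%:E * (Vint a (@UHP R) (fun z => (`|f z * sig z|%:E) `^ p)) `^ (p^-1))%E.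
Proof.
move=> a1 _ ga p1 pq yPhi yPsi [Phic [cPhi bPhi]] [Psic [cPsi bPsi]] wom wsig C0 bump.
have [K [K0 HK]] :=
  cut_bound a1 ga p1 pq yPhi yPsi cPhi cPsi bPhi bPsi wom wsig C0 bump.
have p0 : 0 < p by lra.
have q0 : 0 < q by lra.
exists K; split => // f mf.
set I := Vint a _ (fun z => (`|f z * sig z|%:E `^ p)%E) => Ioo.
have I0 : (0 <= I)%E by apply: Vint_ge0 => z _; exact: poweR_ge0.
have key S : 0 < S -> (I <= (S `^ p)%:E)%E ->
    ((Vint a (@UHP R) (fun z => ((om z)%:E * `|Tag a g f z|) `^ q)) `^ (q^-1)
      <= (K * S)%:E)%E.
  move=> S0 IS.
  have H := Vint_Tag_le mf q0 wom (fun N => HK f S N S0 mf IS).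
  have KS0 : 0 <= K * S by rewrite mulr_ge0 ?(ltW K0) ?(ltW S0).
  have -> : (K * S)%:E = ((((K * S) `^ q)%:E) `^ q^-1)%E.
    by rewrite poweR_EFin -powRrM mulfV ?gt_eqF// powRr1.
  apply: gt0_ler_poweR H; rewrite ?invr_ge0 ?(ltW q0)// in_itv/= leey andbT.
    by apply: Vint_ge0 => z _; exact: poweR_ge0.
  by rewrite lee_fin powR_ge0.
move: I0 key Ioo; case: I => [r| |]// + key _; rewrite lee_fin le_eqVlt => /predU1P[r0|r0].
  (* If [I] is 0, [key] holds for every positive [S]; the choice [S = e / K] makes the bound an
     arbitrary [e]. *)
  rewrite -r0 poweR0r ?invr_neq0 ?gt_eqF// mule0.
  apply/lee_addgt0Pr => e e0; rewrite add0e.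
  have -> : e = K * (e / K) by rewrite mulrC divfK// gt_eqF.
  by apply: key; rewrite ?divr_gt0// -r0 lee_fin powR_ge0.
rewrite poweR_EFin -EFinM; apply: key; first by rewrite powR_gt0.
by rewrite lee_fin -powRrM mulVf ?gt_eqF// powRr1// ltW.
Qed.
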